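(* If $\Gamma$ is a finite digraph, $\mathbb{F}$ is a field and $\mathbf{k}$ is a commutative $\mathbb{F}$-algebra with 1, then $L_{\mathbf{k}}(\Gamma)$ is also an $\mathbb{F}$-algebra and $$GKdim\, L_{\mathbf{k}}(\Gamma)=GKdim\, L_{\mathbb{F}}(\Gamma)+GKdim(\mathbf{k}),$$ where all Gelfand–Kirillov dimensions are taken over $\mathbb{F}$.
   Context: A digraph $\Gamma=(V,E,s,t)$ has vertex set $V$, arrow set $E$, and source and target maps $s,t:E\to V$ (written $se$, $te$). It is finite if $V$ and $E$ are finite. For a commutative ring $\mathbf{k}$ with 1, the Leavitt path algebra $L_{\mathbf{k}}(\Gamma)$ is the $\mathbf{k}$-algebra generated by $V\sqcup E\sqcup E^*$, where $E^*=\{e^*: e\in E\}$ with $s(e^* )=te$, $t(e^* )=se$, subject to: (V) $vw=\delta_{v,w}v$ for $v,w\in V$; (E) $(se)e=e=e(te)$ for $e\in E\sqcup E^*$; (CK1) $e^*f=\delta_{e,f}\,te$ for $e,f\in E$; (CK2) $v=\sum_{se=v}ee^*$ for all $v\in V$ with $0<|s^{-1}(v)|<\infty$. For $\Gamma$ finite it has $1=\sum_{v\in V}v$. For a finitely generated $\mathbb{F}$-algebra $A$ with 1, $GKdim\,A=\limsup_{n\to\infty}\frac{\log(\dim_{\mathbb{F}} W^n)}{\log n}\in[0,\infty]$, where $W$ is a finite dimensional $\mathbb{F}$-subspace generating $A$ with $1\in W$, and $W^n$ is the $\mathbb{F}$-span of $n$-fold products of elements of $W$ (the value is independent of $W$).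 For an $\mathbb{F}$-algebra with 1 that is not finitely generated, $GKdim\,A$ has its standard meaning: the supremum of $GKdim\,B$ over finitely generated unital subalgebras $B\subseteq A$. The value $\infty$ is allowed, and a sum with an infinite term is infinite. *)

(* Defs.v *)
From HB Require Import structures.
From mathcomp Require Import all_boot all_order all_algebra.
From mathcomp Require Import all_classical all_reals all_analysis.

Set Implicit Arguments.
Unset Strict Implicit.
Unset Printing Implicit Defensive.

Import Order.TTheory GRing.Theory Num.Theory.
Local Open Scope classical_set_scope.
Local Open Scope ring_scope.
Local Open Scope quotient_scope.

(* MathComp's [algType] excludes the zero ring, but the Leavitt path algebra   *)
(* of the empty digraph is zero.  So a unital F-algebra is given here by a     *)
(* possibly zero ring A and its structure map phi : F -> A, a ring morphism    *)
(* with central image; scalars act by x |-> phi a * x.  For an [algType] over  *)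
(* F the structure map is [GRing.in_alg A].                                          *)
Definition central_map (F A : pzRingType) (phi : {rmorphism F -> A}) : Prop :=
  forall (a : F) (x : A), GRing.comm (phi a) x.

Record digraph := Digraph {
  vert : finType;
  arrow : finType;
  source : arrow -> vert;
  target : arrow -> vert
}.

(* L_k(G) is built as the (a priori non-unital) k-algebra presented by the     *)
(* generators V + E + E^* and the relations (V), (E), (CK1), (CK2): formal     *)
(* expressions modulo the least congruence that contains the axioms of         *)
(* associative k-algebras and these relations.  The unit is derived.           *)
Section Leavitt.
Variables (k : comPzRingType) (G : digraph).

Inductive lpa_expr : Type :=
| EVert of vert G
| EArrow of arrow G
| EGhost of arrow G
| EZero
| EOpp of lpa_expr
| EAdd of lpa_expr & lpa_expr
| EScale of k & lpa_expr
| EMul of lpa_expr & lpa_expr.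

Inductive lpa_rel : lpa_expr -> lpa_expr -> Prop :=
| RRefl x : lpa_rel x x
| RSym x y : lpa_rel x y -> lpa_rel y x
| RTrans x y z : lpa_rel x y -> lpa_rel y z -> lpa_rel x z
| ROpp x x' : lpa_rel x x' -> lpa_rel (EOpp x) (EOpp x')
| RAdd x x' y y' :
    lpa_rel x x' -> lpa_rel y y' -> lpa_rel (EAdd x y) (EAdd x' y')
| RScale a x x' : lpa_rel x x' -> lpa_rel (EScale a x) (EScale a x')
| RMul x x' y y' :
    lpa_rel x x' -> lpa_rel y y' -> lpa_rel (EMul x y) (EMul x' y')
| RAddA x y z : lpa_rel (EAdd x (EAdd y z)) (EAdd (EAdd x y) z)
| RAddC x y : lpa_rel (EAdd x y) (EAdd y x)
| RAdd0 x : lpa_rel (EAdd EZero x) x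
| RAddN x : lpa_rel (EAdd (EOpp x) x) EZero
| RScaleA a b x : lpa_rel (EScale a (EScale b x)) (EScale (a * b) x)
| RScale1 x : lpa_rel (EScale 1 x) x
| RScaleDr a x y :
    lpa_rel (EScale a (EAdd x y)) (EAdd (EScale a x) (EScale a y))
| RScaleDl a b x :
    lpa_rel (EScale (a + b) x) (EAdd (EScale a x) (EScale b x))
| RMulA x y z : lpa_rel (EMul x (EMul y z)) (EMul (EMul x y) z)
| RMulDl x y z : lpa_rel (EMul (EAdd x y) z) (EAdd (EMul x z) (EMul y z))
| RMulDr x y z : lpa_rel (EMul x (EAdd y z)) (EAdd (EMul x y) (EMul x z))
| RScaleAl a x y : lpa_rel (EScale a (EMul x y)) (EMul (EScale a x) y)
| RScaleAr a x y : lpa_rel (EScale a (EMul x y)) (EMul x (EScale a y))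
| RV v w : lpa_rel (EMul (EVert v) (EVert w)) (if v == w then EVert v else EZero)
| RE_source e : lpa_rel (EMul (EVert (source e)) (EArrow e)) (EArrow e)
| RE_target e : lpa_rel (EMul (EArrow e) (EVert (target e))) (EArrow e)
| RE_ghost_source e : lpa_rel (EMul (EVert (target e)) (EGhost e)) (EGhost e)
| RE_ghost_target e : lpa_rel (EMul (EGhost e) (EVert (source e))) (EGhost e)
| RCK1 e f : lpa_rel (EMul (EGhost e) (EArrow f))
                     (if e == f then EVert (target e) else EZero)
| RCK2 v : (exists e, source e = v) ->
    lpa_rel (EVert v)
      (\big[EAdd/EZero]_(e | source e == v) EMul (EArrow e) (EGhost e)).

HB.instance Definition _ := gen_eqMixin lpa_expr.
HB.instance Definition _ := gen_choiceMixin lpa_expr.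

Definition lpa_relb (x y : lpa_expr) : bool := `[< lpa_rel x y >].

Fact lpa_relb_refl : reflexive lpa_relb.
Proof. by move=> x; apply/asboolP; exact: RRefl. Qed.

Fact lpa_relb_sym : symmetric lpa_relb.
Proof. by move=> x y; apply/asboolP/asboolP; exact: RSym. Qed.

Fact lpa_relb_trans : transitive lpa_relb.
Proof.
by move=> y x z /asboolP xy /asboolP yz; apply/asboolP; exact: RTrans xy yz.
Qed.

Canonical lpa_equiv := EquivRel lpa_relb lpa_relb_refl lpa_relb_sym lpa_relb_trans.

Definition leavitt : Type := {eq_quot lpa_relb}.

HB.instance Definition _ := Choice.on leavitt.
HB.instance Definition _ := EqQuotient.on leavitt.

Definition lpa_class (x : lpa_expr) : leavitt := \pi_leavitt x.

Lemma lpa_classP x y : lpa_class x = lpa_class y <-> lpa_rel x y.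
Proof.
split=> [/eqmodP/asboolP//|xy]; apply/eqmodP; exact/asboolP.
Qed.

Lemma lpa_classW (P : leavitt -> Prop) :
  (forall x, P (lpa_class x)) -> forall x, P x.
Proof. by move=> PE x; rewrite -[x]reprK; exact: PE. Qed.

Lemma lpa_reprP x : lpa_rel (repr (lpa_class x)) x.
Proof. by apply/lpa_classP; rewrite /lpa_class reprK. Qed.

Definition lpa_vert (v : vert G) : leavitt := lpa_class (EVert v).
Definition lpa_arrow (e : arrow G) : leavitt := lpa_class (EArrow e).
Definition lpa_ghost (e : arrow G) : leavitt := lpa_class (EGhost e).

Definition lpa_zero : leavitt := lpa_class EZero.
Definition lpa_opp (x : leavitt) : leavitt := lpa_class (EOpp (repr x)).
Definition lpa_add (x y : leavitt) : leavitt :=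
  lpa_class (EAdd (repr x) (repr y)).
Definition lpa_scale (a : k) (x : leavitt) : leavitt :=
  lpa_class (EScale a (repr x)).
Definition lpa_mul (x y : leavitt) : leavitt :=
  lpa_class (EMul (repr x) (repr y)).

Lemma lpa_classN x : lpa_class (EOpp x) = lpa_opp (lpa_class x).
Proof. by apply/esym/lpa_classP; apply: ROpp; exact: lpa_reprP. Qed.

Lemma lpa_classD x y :
  lpa_class (EAdd x y) = lpa_add (lpa_class x) (lpa_class y).
Proof. by apply/esym/lpa_classP; apply: RAdd; exact: lpa_reprP. Qed.

Lemma lpa_classZ a x : lpa_class (EScale a x) = lpa_scale a (lpa_class x).
Proof. by apply/esym/lpa_classP; apply: RScale; exact: lpa_reprP. Qed.

Lemma lpa_classM x y :
  lpa_class (EMul x y) = lpa_mul (lpa_class x) (lpa_class y).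
Proof. by apply/esym/lpa_classP; apply: RMul; exact: lpa_reprP. Qed.

Let pushE := (lpa_classN, lpa_classD, lpa_classZ, lpa_classM).

Fact lpa_addA : associative lpa_add.
Proof.
elim/lpa_classW=> x; elim/lpa_classW=> y; elim/lpa_classW=> z.
by rewrite -!pushE; apply/lpa_classP; exact: RAddA.
Qed.

Fact lpa_addC : commutative lpa_add.
Proof.
elim/lpa_classW=> x; elim/lpa_classW=> y.
by rewrite -!pushE; apply/lpa_classP; exact: RAddC.
Qed.

Fact lpa_add0 : left_id lpa_zero lpa_add.
Proof. by elim/lpa_classW=> x; rewrite -!pushE; apply/lpa_classP; exact: RAdd0. Qed.

Fact lpa_addN : left_inverse lpa_zero lpa_opp lpa_add.
Proof. by elim/lpa_classW=> x; rewrite -!pushE; apply/lpa_classP; exact: RAddN. Qed.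

HB.instance Definition _ :=
  GRing.isZmodule.Build leavitt lpa_addA lpa_addC lpa_add0 lpa_addN.

Fact lpa_scaleA a b x : lpa_scale a (lpa_scale b x) = lpa_scale (a * b) x.
Proof.
by elim/lpa_classW: x => x; rewrite -!pushE; apply/lpa_classP; exact: RScaleA.
Qed.

Fact lpa_scale1 : left_id 1 lpa_scale.
Proof. by elim/lpa_classW=> x; rewrite -!pushE; apply/lpa_classP; exact: RScale1. Qed.

Fact lpa_scaleDr : right_distributive lpa_scale lpa_add.
Proof.
move=> a; elim/lpa_classW=> x; elim/lpa_classW=> y.
by rewrite -!pushE; apply/lpa_classP; exact: RScaleDr.
Qed.

Fact lpa_scaleDl x : {morph lpa_scale^~ x : a b / a + b >-> lpa_add a b}.
Proof.
move=> a b; elim/lpa_classW: x => x.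
by rewrite -!pushE; apply/lpa_classP; exact: RScaleDl.
Qed.

HB.instance Definition _ := GRing.Zmodule_isLmodule.Build k leavitt
  lpa_scaleA lpa_scale1 lpa_scaleDr lpa_scaleDl.

Fact lpa_mulA : associative lpa_mul.
Proof.
elim/lpa_classW=> x; elim/lpa_classW=> y; elim/lpa_classW=> z.
by rewrite -!pushE; apply/lpa_classP; exact: RMulA.
Qed.

Fact lpa_mulDl : left_distributive lpa_mul lpa_add.
Proof.
elim/lpa_classW=> x; elim/lpa_classW=> y; elim/lpa_classW=> z.
by rewrite -!pushE; apply/lpa_classP; exact: RMulDl.
Qed.

Fact lpa_mulDr : right_distributive lpa_mul lpa_add.
Proof.
elim/lpa_classW=> x; elim/lpa_classW=> y; elim/lpa_classW=> z.
by rewrite -!pushE; apply/lpa_classP; exact: RMulDr.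
Qed.

Fact lpa_scaleAl a x y : lpa_scale a (lpa_mul x y) = lpa_mul (lpa_scale a x) y.
Proof.
elim/lpa_classW: x => x; elim/lpa_classW: y => y.
by rewrite -!pushE; apply/lpa_classP; exact: RScaleAl.
Qed.

Fact lpa_scaleAr a x y : lpa_scale a (lpa_mul x y) = lpa_mul x (lpa_scale a y).
Proof.
elim/lpa_classW: x => x; elim/lpa_classW: y => y.
by rewrite -!pushE; apply/lpa_classP; exact: RScaleAr.
Qed.

Definition lpa_one : leavitt := \sum_(v : vert G) lpa_vert v.

Let mulDl : left_distributive lpa_mul +%R := lpa_mulDl.
Let mulDr : right_distributive lpa_mul +%R := lpa_mulDr.
Let classN x : lpa_class (EOpp x) = - lpa_class x := lpa_classN x.
Let classD x y : lpa_class (EAdd x y) = lpa_class x + lpa_class y :=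
  lpa_classD x y.

Let mul0l x : lpa_mul 0 x = 0.
Proof. by apply: (addrI (lpa_mul 0 x)); rewrite -mulDl !addr0. Qed.

Let mul0r x : lpa_mul x 0 = 0.
Proof. by apply: (addrI (lpa_mul x 0)); rewrite -mulDr !addr0. Qed.

Let mul_suml (I : Type) (r : seq I) (f : I -> leavitt) x :
  lpa_mul (\sum_(i <- r) f i) x = \sum_(i <- r) lpa_mul (f i) x.
Proof. by elim/big_rec2: _ => [|i y1 y2 _ <-]; [exact: mul0l|exact: mulDl]. Qed.

Let mul_sumr (I : Type) (r : seq I) (f : I -> leavitt) x :
  lpa_mul x (\sum_(i <- r) f i) = \sum_(i <- r) lpa_mul x (f i).
Proof. by elim/big_rec2: _ => [|i y1 y2 _ <-]; [exact: mul0r|exact: mulDr]. Qed.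

Let mulVV v w :
  lpa_mul (lpa_vert v) (lpa_vert w) = if v == w then lpa_vert v else 0.
Proof.
rewrite -lpa_classM; have /lpa_classP -> := RV v w.
by case: eqP.
Qed.

Let mul1V v : lpa_mul lpa_one (lpa_vert v) = lpa_vert v.
Proof.
rewrite mul_suml (bigD1 v)//= mulVV eqxx big1 ?addr0// => w wv.
by rewrite mulVV (negbTE wv).
Qed.

Let mulV1 v : lpa_mul (lpa_vert v) lpa_one = lpa_vert v.
Proof.
rewrite mul_sumr (bigD1 v)//= mulVV eqxx big1 ?addr0// => w wv.
by rewrite mulVV eq_sym (negbTE wv).
Qed.

Fact lpa_mul1l : left_id lpa_one lpa_mul.
Proof.
have fixl x v : lpa_rel (EMul (EVert v) x) x ->
    lpa_mul lpa_one (lpa_class x) = lpa_class x.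
  move=> /lpa_classP <-.
  by rewrite lpa_classM lpa_mulA -/(lpa_vert v) mul1V.
elim/lpa_classW; elim=> [v|e|e||x IH|x IHx y IHy|a x IH|x IHx y IHy].
- exact: mul1V.
- exact: fixl (RE_source e).
- exact: fixl (RE_ghost_source e).
- exact: mul0r.
- rewrite classN.
  by apply: (addrI (lpa_class x)); rewrite -{1}IH -mulDr !subrr mul0r.
- by rewrite classD mulDr IHx IHy.
- by rewrite lpa_classZ -lpa_scaleAr IH.
- by rewrite lpa_classM lpa_mulA IHx.
Qed.

Fact lpa_mul1r : right_id lpa_one lpa_mul.
Proof.
have fixr x v : lpa_rel (EMul x (EVert v)) x ->
    lpa_mul (lpa_class x) lpa_one = lpa_class x.
  move=> /lpa_classP <-.
  by rewrite lpa_classM -lpa_mulA -/(lpa_vert v) mulV1.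
elim/lpa_classW; elim=> [v|e|e||x IH|x IHx y IHy|a x IH|x IHx y IHy].
- exact: mulV1.
- exact: fixr (RE_target e).
- exact: fixr (RE_ghost_target e).
- exact: mul0l.
- rewrite classN.
  by apply: (addrI (lpa_class x)); rewrite -{1}IH -mulDl !subrr mul0l.
- by rewrite classD mulDl IHx IHy.
- by rewrite lpa_classZ -lpa_scaleAl IH.
- by rewrite lpa_classM -lpa_mulA IHy.
Qed.

HB.instance Definition _ := GRing.Zmodule_isPzRing.Build leavitt
  lpa_mulA lpa_mul1l lpa_mul1r lpa_mulDl lpa_mulDr.

Definition lpa_in (a : k) : leavitt := a *: (1 : leavitt).

Lemma lpa_inE a x : lpa_in a * x = a *: x.
Proof. by rewrite -[RHS](congr1 ( *:%R a) (mul1r x)); exact/esym/lpa_scaleAl. Qed.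

Lemma lpa_in_comm a x : GRing.comm (lpa_in a) x.
Proof.
rewrite /GRing.comm lpa_inE -[LHS](congr1 ( *:%R a) (mulr1 x)).
exact: lpa_scaleAr.
Qed.

Fact lpa_in_zmod_morphism : zmod_morphism lpa_in.
Proof. by move=> a b; rewrite /lpa_in scalerBl. Qed.

Fact lpa_in_monoid_morphism : monoid_morphism lpa_in.
Proof.
by split=> [|a b]; rewrite ?lpa_inE /lpa_in ?scale1r ?scalerA.
Qed.

HB.instance Definition _ :=
  GRing.isZmodMorphism.Build k leavitt lpa_in lpa_in_zmod_morphism.
HB.instance Definition _ :=
  GRing.isMonoidMorphism.Build k leavitt lpa_in lpa_in_monoid_morphism.

End Leavitt.

Arguments lpa_in : clear implicits.

(* L_k(G) as an F-algebra, when k is an F-algebra through phi. *)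
Definition lpa_alg (F : pzRingType) (k : comPzRingType)
    (phi : {rmorphism F -> k}) (G : digraph) : {rmorphism F -> leavitt k G} :=
  lpa_in k G \o phi.

Section GelfandKirillov.
Variables (R : realType) (F : fieldType) (A : pzRingType).
Variable phi : {rmorphism F -> A}.
Implicit Types (X U W B : set A).

Definition lin_indep n (v : 'I_n -> A) : Prop :=
  forall c : 'I_n -> F, \sum_(i < n) phi (c i) * v i = 0 -> forall i, c i = 0.

Definition lin_span X : set A :=
  [set y | exists n (c : 'I_n -> F) (x : 'I_n -> A),
     (forall i, X (x i)) /\ y = \sum_(i < n) phi (c i) * x i].

(* The dimension of a subspace U, +oo if U is not finite dimensional. *)
Definition lin_dim U : \bar R :=
  ereal_sup [set n%:R%:E | n in [set n | exists v : 'I_n -> A,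
                                   (forall i, U (v i)) /\ lin_indep v]].

Definition fin_dim_subspace W : Prop :=
  exists s : seq A, W = lin_span [set` s].

Definition unital_subalg B : Prop :=
  [/\ B 1, forall (a : F) x y, B x -> B y -> B (phi a * x + y)
    & forall x y, B x -> B y -> B (x * y)].

Definition subalg_gen X : set A := smallest unital_subalg X.

Definition fin_gen_subalg B : Prop :=
  exists s : seq A, B = subalg_gen [set` s].

Definition subspace_pow W n : set A :=
  lin_span [set \prod_(i < n) x i | x in [set x : 'I_n -> A | forall i, W (x i)]].

(* Since lne 0 = -oo, this is -oo when A is the zero ring; otherwise it is     *)
(* nonnegative.                                                                *)
Definition growth_exponent W : \bar R :=
  limn_esup (fun n => lne (lin_dim (subspace_pow W n)) * ((ln n%:R)^-1)%:E)%E.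

(* GKdim of a finitely generated unital subalgebra B; all the spaces W that    *)
(* are allowed here have the same growth exponent.                             *)
Definition GKdim_fin_gen B : \bar R :=
  ereal_sup [set growth_exponent W | W in
    [set W | [/\ fin_dim_subspace W, W 1 & subalg_gen W = B]]].

Definition GKdim : \bar R :=
  ereal_sup [set GKdim_fin_gen B | B in fin_gen_subalg].

End GelfandKirillov.

Arguments GKdim R {F A} phi.

(* Main.v *)
Require Import Defs.
From HB Require Import structures.
From mathcomp Require Import all_boot all_order all_algebra.
From mathcomp Require Import all_classical all_reals all_analysis.
From mathcomp Require Import zify ring lra.

(* [L_k(G)] is a free [k]-module on normal words: reduced paths in the double
   graph, where [e e^*] is eliminated for one special arrow [e] at each
   non-sink by means of (CK2).  Independence is seen on an explicit action of
   the algebra on coefficient functions; and products of normal words have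
   integer coordinates, in words that are not longer than the two factors put
   together.  Hence, for a space U of coefficients, the n-th power of the span
   of U and the words of length at most m lies between the free spans of U^n
   and the words of length at most n and n m respectively, so its dimension is
   controlled by dim U^n times a number of words.  Normal words are walks in a
   finite graph, so the number of those of length at most n is either of exact
   order n^d for some d or larger than every power of n; since this growth rate
   is a limit, and not only an upper limit, growth exponents add up. *)

Set Implicit Arguments.
Unset Strict Implicit.
Unset Printing Implicit Defensive.

Import Order.TTheory GRing.Theory Num.Theory.
Local Open Scope classical_set_scope.
Local Open Scope ring_scope.

(** * Growth rates of walks in finite graphs *)

(** What the digraph contributes is a count of words of [G] in which [k] does not occur. One value
    therefore serves all [k] at once, and it is identified as the dimension of L_F by taking
    [k = F], whose own dimension is 0. The coefficient functions acted upon are arbitrary functions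
    on words, with no finiteness of support, so the module needs no construction. The price is that
    the defining relations are checked on functions vanishing off the normal words, and that this
    subspace has to be shown stable. Zero rings are treated apart at the end: their dimension is -oo
    by the convention for the logarithm of 0, and both sides of the formula are then -oo. *)

Section GrowthRates.
Implicit Types (u v w g : nat -> nat) (c d m n : nat).
Local Open Scope nat_scope.

(** The constant stands on the side of [u], which keeps lower bounds within natural numbers; such a
    bound also forces [u n] to be positive for positive n. *)
Definition grows_at_least d u := exists c, forall n, 0 < n -> n ^ d <= c * u n.
Definition grows_at_most d u := exists c, forall n, 0 < n -> u n <= c * n ^ d.

Definition has_growth_rate u :=
  (forall d, grows_at_least d u) \/
  (exists d, grows_at_least d u /\ grows_at_most d u).

Lemma leq_expl m n d : m <= n -> m ^ d <= n ^ d.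
Proof. by case: d => // d mn; rewrite leq_exp2r. Qed.

Lemma leq_exp_shift m n d : 0 < n -> (n + m) ^ d <= m.+1 ^ d * n ^ d.
Proof. by move=> n0; rewrite -expnMn; apply: leq_expl; nia. Qed.

(** For n > m the hypotheses are used at n - m, and n is at most (m + 1)(n - m). The finitely many n
    <= m only cost a constant, because [u] is positive there. *)
Lemma grows_at_least_shift d C m u v : grows_at_least d v ->
  (forall n, 0 < n -> v n <= C * u (n + m)) -> (forall n, 0 < n -> 0 < u n) ->
  grows_at_least d u.
Proof.
move=> [c vge] vu u0; exists (m.+1 ^ d * (c * C).+1) => n n0.
have [nm|mn] := leqP n m.
  apply: leq_trans (_ : m.+1 ^ d <= _); first exact/leq_expl/leqW.
  by rewrite -mulnA leq_pmulr// muln_gt0/= u0.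
rewrite -{1}(subnK (ltnW mn)).
have nm0 : 0 < n - m by rewrite subn_gt0.
apply: leq_trans (leq_exp_shift _ _ nm0) _; rewrite -mulnA leq_mul2l.
apply/orP; right; apply: leq_trans (vge _ nm0) _.
have := vu _ nm0; rewrite (subnK (ltnW mn)) => vun.
apply: leq_trans (leq_mul (leqnn c) vun) _.
by rewrite mulnA leq_mul2r leqnSn orbT.
Qed.

Lemma grows_at_most_shift d C m u v : grows_at_most d v ->
  (forall n, 0 < n -> u n <= C * v (n + m)) -> grows_at_most d u.
Proof.
move=> [c vle] uv; exists (C * c * m.+1 ^ d) => n n0.
apply: leq_trans (uv _ n0) _; rewrite -!mulnA leq_mul2l; apply/orP; right.
apply: leq_trans (vle _ _) _; first by rewrite addn_gt0 n0.
by rewrite leq_mul2l leq_exp_shift ?orbT.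
Qed.

Lemma has_growth_rate_shift C m u v : has_growth_rate v ->
  (forall n, 0 < n -> v n <= C * u (n + m)) ->
  (forall n, 0 < n -> u n <= C * v (n + m)) ->
  (forall n, 0 < n -> 0 < u n) -> has_growth_rate u.
Proof.
move=> [vd|[d [vge vle]]] vu uv u0.
  by left=> d; apply: grows_at_least_shift (vd d) vu u0.
right; exists d; split; first exact: grows_at_least_shift vge vu u0.
exact: grows_at_most_shift vle uv.
Qed.

Lemma has_growth_rate_const c : 0 < c -> has_growth_rate (fun=> c).
Proof.
by move=> c0; right; exists 0; split; [exists 1|exists c] => n _; rewrite expn0 ?muln1 ?mul1n.
Qed.

Lemma grows_at_leastW d e u : d <= e -> grows_at_least e u -> grows_at_least d u.
Proof.
move=> de [c uc]; exists c => n n0; apply: leq_trans (uc _ n0).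
by rewrite leq_pexp2l.
Qed.

Lemma grows_at_mostW d e u : d <= e -> grows_at_most d u -> grows_at_most e u.
Proof.
move=> de [c uc]; exists c => n n0; apply: leq_trans (uc _ n0) _.
by rewrite leq_mul2l leq_pexp2l ?orbT.
Qed.

Lemma grows_at_leastDl d u v : grows_at_least d u -> grows_at_least d (fun n => u n + v n).
Proof.
by move=> [c uc]; exists c => n n0; apply: leq_trans (uc _ n0) _; rewrite leq_mul2l leq_addr orbT.
Qed.

Lemma grows_at_leastDr d u v : grows_at_least d v -> grows_at_least d (fun n => u n + v n).
Proof.
by move=> [c uc]; exists c => n n0; apply: leq_trans (uc _ n0) _; rewrite leq_mul2l leq_addl orbT.
Qed.

Lemma grows_at_mostD d u v : grows_at_most d u -> grows_at_most d v ->
  grows_at_most d (fun n => u n + v n).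
Proof.
move=> [c uc] [c' vc]; exists (c + c') => n n0; rewrite mulnDl.
by rewrite leq_add ?uc ?vc.
Qed.

Lemma has_growth_rateD u v : has_growth_rate u -> has_growth_rate v ->
  has_growth_rate (fun n => u n + v n).
Proof.
move=> [ud|[d [ud du]]]; first by left=> d; exact/grows_at_leastDl.
move=> [ve|[e [ve ev]]]; first by left=> e; exact/grows_at_leastDr.
right; have [de|/ltnW ed] := leqP d e.
- exists e; split; first exact: grows_at_leastDr.
  by apply: grows_at_mostD => //; exact: grows_at_mostW du.
- exists d; split; first exact: grows_at_leastDl.
  by apply: grows_at_mostD => //; exact: grows_at_mostW ev.
Qed.

Lemma has_growth_rate_sum (I : Type) (r : seq I) (P : pred I) (f : I -> nat -> nat) g :
  has_growth_rate g -> (forall i, P i -> has_growth_rate (f i)) ->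
  has_growth_rate (fun n => g n + \sum_(i <- r | P i) f i n).
Proof.
move=> gr fr; elim: r => [|i r IH].
  have -> // : (fun n => g n + \sum_(i <- [::] | P i) f i n) = g.
  by under eq_fun do rewrite big_nil addn0.
have [Pi|Pi] := boolP (P i); last first.
  by under eq_fun do rewrite big_cons (negbTE Pi).
under eq_fun do rewrite big_cons Pi addnCA.
exact/has_growth_rateD/IH/fr.
Qed.

(** Discrete integration: along the progression 1 + j m the increments of [w] are at least of order
    j^d, so they add up to order j^(d+1). In [C], the factor d + 1 comes from the difference of
    consecutive (d+1)-st powers, and 2^d from replacing j + 2 by j + 1. *)
Lemma grows_at_least_step d m w g : 0 < m -> {homo w : i j / i <= j} ->
  (forall n, 0 < n -> w n + g n <= w (n + m)) ->
  grows_at_least d g -> 0 < w 1 -> grows_at_least d.+1 w.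
Proof.
move=> m0 wmono wg [c gc] w1; pose C := d.+1 * 2 ^ d * c.
have key j : j.+1 ^ d.+1 <= C * w (1 + j * m).
  elim: j => [|j IH].
    have := gc 1 isT; rewrite exp1n addn0 exp1n => c0; rewrite muln_gt0 w1 andbT.
    by rewrite !muln_gt0 expn_gt0 /=; case: (c) c0.
  have -> : 1 + j.+1 * m = 1 + j * m + m by rewrite mulSn; lia.
  apply: leq_trans (leq_mul (leqnn C) (wg _ _)) => //; rewrite mulnDr.
  have step : j.+2 ^ d.+1 <= j.+1 ^ d.+1 + d.+1 * j.+2 ^ d.
    rewrite -leq_subLR subn_exp; have -> : j.+2 - j.+1 = 1 by lia.
    rewrite mul1n -[X in X * _](card_ord d.+1) -sum_nat_const leq_sum// => i _.
    move=> /=; apply: leq_trans (_ : j.+2 ^ (d - i) * j.+2 ^ i <= _).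
      by rewrite leq_mul2l leq_expl ?orbT.
    by rewrite -expnD subnK// -ltnS.
  apply: leq_trans step _; apply: leq_add => //.
  rewrite /C -!mulnA leq_mul2l; apply/orP; right.
  have := @leq_exp_shift 1 j.+1 d isT; rewrite addn1 => /leq_trans; apply.
  rewrite leq_mul2l; apply/orP; right; apply: leq_trans (gc _ _) => //.
  by apply: leq_expl; nia.
(* With j = (n - 1) / m, the largest term 1 + j m not exceeding n, one has n <= m (j + 1). *)
exists (m ^ d.+1 * C) => n n0.
have nE : n = 1 + (n.-1 %/ m) * m + n.-1 %% m.
  by have := divn_eq n.-1 m; lia.
have nlt := ltn_pmod n.-1 m0.
apply: leq_trans (_ : (m * (n.-1 %/ m).+1) ^ d.+1 <= _).
  by apply: leq_expl; rewrite mulnS mulnC; lia.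
rewrite expnMn -mulnA leq_mul2l; apply/orP; right; apply: leq_trans (key _) _.
by rewrite leq_mul2l wmono ?orbT// {2}nE leq_addr.
Qed.

Lemma grows_at_most_step d w g : (forall n, 0 < n -> w n.+1 <= w n + g n) ->
  grows_at_most d g -> grows_at_most d.+1 w.
Proof.
move=> wg [c gc]; exists (c + w 1) => -[//|n] _; elim: n => [|n IH].
  by rewrite exp1n muln1 leq_addl.
apply: leq_trans (wg _ _) _ => //.
apply: leq_trans (leq_add IH (gc _ _)) _ => //.
have le : n.+1 ^ d <= n.+2 ^ d by exact: leq_expl.
rewrite !expnS; have := leq_mul (leqnn ((c + w 1) * n.+2)) le; nia.
Qed.

End GrowthRates.

(** * Walks from a vertex and their growth *)

Section Walks.
Local Open Scope nat_scope.
Variables (T : finType) (H : rel T).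

(** All lengths are counted together: these are the nonempty walks with at most n vertices. *)
Fixpoint walks n x : nat :=
  if n is n'.+1 then (\sum_(y | H x y) walks n' y).+1 else 0.

Lemma walksS n x : walks n.+1 x = 1 + \sum_(y | H x y) walks n y.
Proof. by []. Qed.

Lemma walks_gt0 n x : 0 < n -> 0 < walks n x.
Proof. by case: n. Qed.

Lemma walks_homo x : {homo walks^~ x : m n / m <= n}.
Proof.
apply: homo_leq => // [n p m|n]; first exact: leq_trans.
elim: n x => // n IH x /=; rewrite ltnS; apply: leq_sum => y _; exact: IH.
Qed.

Lemma walks_step n x y : H x y -> walks n y <= walks n.+1 x.
Proof. by move=> xy /=; rewrite (bigD1 y)//= leqW// leq_addr. Qed.

(** Walks from y are prefixed by a fixed path from x to y; one without repetition has fewer than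
    [#|T|] edges. *)
Lemma walks_connect n x y : connect H x y -> walks n y <= walks (n + #|T|) x.
Proof.
move=> /connectP[p0 /shortenP[p xp up _] ->] {p0 y}.
have sp : size p <= #|T| by rewrite ltnW// -[_ < _]/(size (x :: p) <= _) -(card_uniqP up) max_card.
apply: leq_trans (walks_homo x (leq_add (leqnn n) sp)).
elim: p x xp {up sp} => [|y p IH] x /=; first by rewrite addn0.
move=> /andP[xy yp]; apply: leq_trans (IH _ yp) _.
by rewrite addnS; exact: walks_step.
Qed.

Lemma connect_pred x y : connect H x y -> x = y \/ exists2 z, connect H x z & H z y.
Proof.
move=> /connectP[p]; case/lastP: p => [|p z] /=; first by left.
rewrite rcons_path last_rcons => /andP[xp pz] ->; right.
by exists (last x p) => //; apply/connectP; exists p.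
Qed.

Definition scc x := [pred y | connect H x y && connect H y x].

(* Along a component carrying a cycle every vertex has a predecessor in the
   component.  If it is always unique, the component is a bare cycle and adds
   one degree; otherwise the increments of the number of walks dominate, up to
   a constant and a shift, that number itself, which outgrows every power. *)
Lemma walks_cyclic_rate x s : H x s -> connect H s x ->
  (forall y, connect H x y -> ~~ connect H y x -> has_growth_rate (walks^~ y)) ->
  has_growth_rate (walks^~ x).
Proof.
move=> xs sx low; pose C := scc x; pose S n := \sum_(u in C) walks n u.
have xC : x \in C by rewrite inE connect0.
have CC u v : u \in C -> v \in C -> connect H u v.
  by rewrite !inE => /andP[_ ux] /andP[xv _]; exact: connect_trans xv.
have xleS n u : u \in C -> walks n u <= S n.
  by move=> uC; rewrite /S (bigD1 u)//= leq_addr.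
have Slex n u : u \in C -> S n <= #|C| * walks (n + #|T|) u.
  move=> uC; rewrite -sum_nat_const; apply: leq_sum => v vC.
  exact/walks_connect/CC.
have C0 : 0 < #|C| by apply/card_gt0P; exists x.
have S0 n : 0 < n -> 0 < S n by move=> n0; apply: leq_trans (xleS _ _ xC); exact: walks_gt0.
have Smono : {homo S : i j / i <= j}.
  by move=> i j ij; apply: leq_sum => u _; exact: walks_homo.
pose indeg y := #|[pred u | (u \in C) && H u y]|.
have indeg_gt0 y : y \in C -> 0 < indeg y.
  move=> yC; have [xy yx] : connect H x y /\ connect H y x by move: yC; rewrite inE => /andP[].
  apply/card_gt0P.
  (* The path starts at s, not at x: for y = x a path from x may be empty, yet x too needs a
     predecessor. *)
  have [<-|[u su uy]] := connect_pred (connect_trans sx xy).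
    by exists x; rewrite inE/= xC.
  exists u; rewrite !inE uy andbT (connect_trans (connect1 xs) su)/=.
  exact: connect_trans (connect1 uy) yx.
(* [g] counts the walks without a second vertex in C: those of one vertex and those leaving C at
   once. In the remaining ones each second vertex y occurs once for every predecessor in C, which
   gives the factor [indeg y]. *)
pose g n := #|C| + \sum_(p | [&& p.1 \in C, H p.1 p.2 & p.2 \notin C]) walks n p.2.
have Sstep n : S n.+1 = g n + \sum_(y in C) indeg y * walks n y.
  rewrite /S; under eq_bigr do rewrite walksS (bigID (mem C))/=.
  rewrite !big_split/= sum1_card addnCA addnC; congr (_ + _ + _).
    by rewrite pair_big_dep.
  rewrite (exchange_big_dep (mem C))/=; last by move=> u y _ /andP[].
  apply: eq_bigr => y yC; rewrite -sum_nat_const; apply: eq_bigl => u.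
  by rewrite inE yC andbT.
have lastx : has_growth_rate S -> has_growth_rate (walks^~ x).
  move=> Sr; apply: (has_growth_rate_shift (C := #|C|) (m := #|T|) Sr) => n n0.
  - exact: Slex.
  - apply: leq_trans (xleS _ _ xC) _; apply: leq_trans (Smono _ _ (leq_addr #|T| _)) _.
    by rewrite leq_pmull.
  - exact: walks_gt0.
apply: lastx.
have [/forallP indeg1|] := boolP [forall y, (y \in C) ==> (indeg y == 1)].
  have SD n : S n.+1 = S n + g n.
    rewrite Sstep addnC; congr (_ + _); apply: eq_bigr => y yC.
    by have /implyP/(_ yC)/eqP -> := indeg1 y; rewrite mul1n.
  have : has_growth_rate g.
    apply: has_growth_rate_sum; first exact: has_growth_rate_const.
    move=> [u y] /and3P[/= uC uy yC]; apply: low.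
      by apply: connect_trans (connect1 uy); move: uC; rewrite inE => /andP[].
    apply: contra yC => yx; rewrite inE yx andbT.
    by apply: connect_trans (connect1 uy); move: uC; rewrite inE => /andP[].
  have S1 : 0 < S 1 by exact: S0.
  have up d : grows_at_least d g -> grows_at_least d.+1 S.
    by move=> gd; apply: (@grows_at_least_step d 1 S g) => // n _; rewrite addn1 SD.
  case=> [gd|[d [gd dg]]].
    by left=> -[|d]; [exact: grows_at_leastW (up 0 (gd 0))|exact: up].
  right; exists d.+1; split; first exact: up.
  by apply: grows_at_most_step dg => n _; rewrite SD.
move=> /forallPn[y]; rewrite negb_imply => /andP[yC indegy].
have {}indegy : 1 < indeg y by rewrite ltn_neqAle eq_sym indegy indeg_gt0.
have SD n : S n + walks n y <= S n.+1.
  rewrite Sstep; apply: leq_trans (leq_addl _ _).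
  rewrite /S (bigD1 y)//= [leqRHS](bigD1 y)//= addnAC leq_add//.
    by rewrite addnn -mul2n leq_mul2r indegy orbT.
  by apply: leq_sum => u /andP[uC _]; rewrite leq_pmull ?indeg_gt0.
left; elim=> [|d IH].
  by exists 1 => n n0; rewrite expn0 mul1n S0.
apply: (@grows_at_least_step d 1 S (walks^~ y)) => //.
- by move=> n _; rewrite addn1.
- apply: (grows_at_least_shift (C := #|C|) (m := #|T|) IH) => n n0.
    exact: Slex.
  exact: walks_gt0.
- exact: S0.
Qed.

(** Induction on the number of vertices reachable from x: a reachable y from which x cannot be
    reached sees strictly fewer vertices. If x is on no cycle, all its successors are of this
    kind. *)
Lemma walks_rate x : has_growth_rate (walks^~ x).
Proof.
move: {2}#|connect H x|.+1 (ltnSn #|connect H x|) => N.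
elim: N x => // N IH x xN.
have low y : connect H x y -> ~~ connect H y x -> has_growth_rate (walks^~ y).
  move=> xy yx; apply: IH; rewrite ltnS in xN; apply: leq_trans xN.
  apply/proper_card/properP; split.
    by apply/fintype.subsetP => z; rewrite !unfold_in; exact: connect_trans.
  by exists x; [rewrite unfold_in|]; [exact: connect0|].
have [/existsP[s /andP[xs sx]]|/existsPn nocyc] := boolP [exists s, H x s && connect H s x].
  exact: walks_cyclic_rate xs sx low.
apply: (@has_growth_rate_shift 1 1 _ (fun n => 1 + \sum_(y | H x y) walks n y)).
- apply: has_growth_rate_sum => [|y xy]; first exact: has_growth_rate_const.
  by apply: low; [exact: connect1|have := nocyc y; rewrite xy].
- by move=> n _; rewrite mul1n addn1.
- move=> n _; rewrite mul1n addn1 add1n -[(_).+1]/(walks n.+2 x).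
  by apply: walks_homo; rewrite !leqW.
- by move=> n; exact: walks_gt0.
Qed.

End Walks.

(** * Normal words and their linear independence *)

Lemma uniq_flatten_map (S T : eqType) (s : seq S) (t : S -> seq T) : uniq s ->
  (forall x, uniq (t x)) -> (forall x y w, w \in t x -> w \in t y -> x = y) ->
  uniq (flatten [seq t x | x <- s]).
Proof.
move=> + ut tI; elim: s => //= x s IH /andP[xs us].
rewrite cat_uniq ut IH// andbT; apply/hasPn => w /flatten_mapP[y ys wy].
by apply: contra xs => wx; rewrite (tI _ _ _ wx wy).
Qed.

Section NormalWords.
Variable G : digraph.
Implicit Types (x y : arrow G + arrow G) (l : seq (arrow G + arrow G)) (z : vert G).
Implicit Types (e f g : arrow G).

Local Notation letter := (arrow G + arrow G)%type.

Definition letter_source x := match x with inl e => source e | inr e => target e end.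
Definition letter_target x := match x with inl e => target e | inr e => source e end.

(* (CK2) at [source e] is used to eliminate [e e^*] for the special arrow [e]. *)
Definition special e := [pick f | source f == source e] == Some e.

(** A ghost followed by an arrow is resolved by (CK1). Among the products of an arrow with its own
    ghost, (CK2) removes exactly one per source. *)
Definition reduced_pair x y :=
  match x, y with
  | inr _, inl _ => false
  | inl e, inr f => ~~ ((e == f) && special e)
  | _, _ => true
  end.

Definition composable :=
  [rel x y : letter | (letter_target x == letter_source y) && reduced_pair x y].

(* [(l, z)] stands for the monomial [l] with range vertex [z], so that
   [([::], z)] is the vertex [z]. *)
Local Notation word := (seq letter * vert G)%type.

Definition word_source l z := if l is x :: _ then letter_source x else z.

Fixpoint normal l z :=
  if l is x :: l' then
    [&& letter_target x == word_source l' z,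
        (if l' is y :: _ then reduced_pair x y else true) & normal l' z]
  else true.

Lemma normal_cons x l z : normal (x :: l) z =
  [&& letter_target x == word_source l z,
      (if l is y :: _ then reduced_pair x y else true) & normal l z].
Proof. by []. Qed.

Global Arguments normal : simpl never.

Lemma normal_tail x l z : normal (x :: l) z -> normal l z.
Proof. by rewrite normal_cons => /and3P[]. Qed.

Lemma special_ex e : exists2 f, special f & source f = source e.
Proof.
case E : [pick f | source f == source e] => [f|]; last first.
  by move: E; case: pickP => // /(_ e); rewrite eqxx.
have fe : source f = source e by move: E; case: pickP => // h /eqP + [<-].
by exists f => //; rewrite /special fe E.
Qed.

Lemma special_inj e f : special e -> special f -> source e = source f -> e = f.
Proof. by rewrite /special => /eqP + /eqP; move=> + + ef; rewrite ef => -> []. Qed.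

(** The enumeration follows the recursion of [walks], so that its size is a number of walks in the
    graph whose vertices are the letters. *)
Fixpoint words_from n (x : letter) : seq word :=
  if n is n'.+1 then
    ([:: x], letter_target x) ::
    flatten [seq [seq (x :: w.1, w.2) | w <- words_from n' y]
            | y <- enum {: letter} & composable x y]
  else [::].

Definition words n : seq word :=
  [seq ([::], z) | z <- enum (vert G)] ++ flatten [seq words_from n x | x <- enum {: letter}].

Lemma size_words_from n x : size (words_from n x) = walks composable n x.
Proof.
elim: n x => //= n IH x; rewrite size_flatten /shape -map_comp sumnE big_map big_filter.
rewrite big_enum_cond/=; congr _.+1; apply: eq_bigr => y _.
by rewrite size_map IH.
Qed.

Lemma size_words n : size (words n) = (#|vert G| + \sum_x walks composable n x)%N.
Proof.
rewrite size_cat size_map -cardE size_flatten /shape -map_comp sumnE big_map big_enum/=.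
by congr addn; apply: eq_bigr => x _; exact: size_words_from.
Qed.

Lemma mem_words_from n x l z :
  (((l, z) : word) \in words_from n x) = [&& normal l z, (size l <= n)%N & ohead l == Some x].
Proof.
elim: n x l z => [|n IH] x l z; first by case: l => [|y l]; rewrite ?andbF.
rewrite /= in_cons; case: l => [|x' l] /=.
  by apply/flatten_mapP => -[y _ /mapP[w _]].
rewrite normal_cons.
apply/orP/and3P => [[/eqP[-> -> ->]|/flatten_mapP[y]]|[/and3P[tx red nl] sl /eqP[x'x]]].
- by split => //; rewrite eqxx.
- rewrite mem_filter => /andP[/andP[xy red] _] /mapP[[l' z'] + [-> -> ->]]/=.
  rewrite IH => /and3P[nl sl /eqP]; case: l' nl sl => //= y' l' nl sl [yy'].
  by rewrite yy' in nl *; split => //; apply/and3P; split.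
- case: l tx red nl sl => [|y l] /= tx red nl sl.
    by left; rewrite x'x -(eqP tx) x'x.
  right; apply/flatten_mapP; exists y.
    by rewrite mem_filter mem_enum andbT /composable /= -x'x tx red.
  by apply/mapP; exists (y :: l, z); rewrite ?x'x// IH; apply/and3P.
Qed.

Lemma mem_words n l z : (((l, z) : word) \in words n) = normal l z && (size l <= n)%N.
Proof.
rewrite mem_cat; case: l => [|x l]/=.
  by apply/orP; left; apply/mapP; exists z; rewrite ?mem_enum.
apply/orP/idP => [[/mapP[]//|/flatten_mapP[y _]]|nl].
  by rewrite mem_words_from => /and3P[] /= -> ->.
right; apply/flatten_mapP; exists x; first by rewrite mem_enum.
by rewrite mem_words_from /= andbA nl eqxx.
Qed.

Lemma uniq_words_from n x : uniq (words_from n x).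
Proof.
elim: n x => //= n IH x; apply/andP; split.
  apply/flatten_mapP => -[y _ /mapP[[l' z'] + [l0]]].
  by rewrite mem_words_from -l0 => /and3P[].
apply: uniq_flatten_map; first by rewrite filter_uniq ?enum_uniq.
  by move=> y; rewrite map_inj_uniq// => -[l z] [l' z'] /= [-> ->].
move=> y y' w /mapP[[l z] lw ->] /mapP[[l' z'] lw' /= [ll' _]].
move: lw lw'; rewrite -ll'.
by rewrite !mem_words_from => /and3P[_ _ /eqP->] /and3P[_ _ /eqP[]].
Qed.

Lemma uniq_words n : uniq (words n).
Proof.
rewrite cat_uniq map_inj_uniq ?enum_uniq/=; last by move=> z z' [].
apply/andP; split.
  apply/hasPn => -[l z] /flatten_mapP[x _]; rewrite mem_words_from => /and3P[_ _ lx].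
  by apply/mapP => -[z' _ [l0]]; rewrite l0 in lx.
apply: uniq_flatten_map => [|x|x y [l z]]; rewrite ?enum_uniq ?uniq_words_from//.
by rewrite !mem_words_from => /and3P[_ _ /eqP->] /and3P[_ _ /eqP[]].
Qed.

Lemma words_rate : (0 < #|vert G|)%N -> has_growth_rate (fun n => size (words n)).
Proof.
move=> G0; under eq_fun do rewrite size_words.
apply: has_growth_rate_sum => [|x _]; first exact: has_growth_rate_const.
exact: walks_rate.
Qed.

End NormalWords.

(** * The action of expressions on coefficient functions *)

Section Representation.
Variables (k : comPzRingType) (G : digraph).
Local Notation letter := (arrow G + arrow G)%type.
Local Notation word := (seq letter * vert G)%type.
Implicit Types (e g h : arrow G) (l : seq letter) (z v : vert G).
Implicit Types f : seq letter -> vert G -> k.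

(* [act_arrow e f] and [act_ghost e f] are the coefficient functions of [e f]
   and [e^* f], for a formal sum [f] of normal words.  The only rewriting step
   is [e e^* y = y - \sum_h h h^* y] for a special [e], [h] ranging over the
   other arrows with the source of [e]; the middle case of [act_arrow] collects
   the terms [h h^* y]. *)
Definition act_arrow e f l z : k :=
  match l with
  | inl h :: l' =>
    if h == e then (if normal l z then f l' z else 0)
    else if special e && (source h == source e) then
      match l' with
      | inr h' :: y => if h' == h then - f (inr e :: y) z else 0
      | _ => 0
      end
    else 0
  | _ => if special e then f (inr e :: l) z else 0
  end.

Definition act_ghost e f l z : k :=
  f (inl e :: l) z +
  match l with
  | inr h :: y => if (h == e) && normal l z then f y z else 0
  | _ => 0
  end.

Fixpoint act (x : lpa_expr k G) f : seq letter -> vert G -> k :=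
  match x with
  | EVert v => fun l z => if word_source l z == v then f l z else 0
  | EArrow e => act_arrow e f
  | EGhost e => act_ghost e f
  | EZero => fun _ _ => 0
  | EOpp x => fun l z => - act x f l z
  | EAdd x y => fun l z => act x f l z + act y f l z
  | EScale a x => fun l z => a * act x f l z
  | EMul x y => act x (act y f)
  end.

Definition normal_supp f := forall l z, ~~ normal l z -> f l z = 0.

Lemma act_supp x f : normal_supp f -> normal_supp (act x f).
Proof.
elim: x f => [v|e|e||x IH|x IHx y IHy|a x IH|x IHx y IHy] f sf l z /= nl //.
- by rewrite sf ?if_same.
- case: l nl => [//|[h|h] l] nl.
  + rewrite /act_arrow; case: eqP => [_|/eqP he]; first by rewrite (negbTE nl).
    case: ifP => // /andP[se /eqP sh]; case: l nl => // -[//|h'] l nl.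
    (* If [inr e :: y] is normal, so is [inl h :: inr h :: y]: the ghosts of e and h have the same
       range, and h is not special since it shares its source with the special arrow e and differs
       from it. *)
    case: eqP => // h'h; rewrite sf ?oppr0//; apply: contra nl.
    rewrite h'h !normal_cons /= sh => /and3P[sl red nl]; rewrite sl nl red eqxx/= !andbT.
    by apply: contra he => /andP[_ sph]; rewrite (special_inj sph se sh).
  + rewrite /act_arrow; case: ifP => // _; rewrite sf//; apply: contra nl.
    exact: normal_tail.
- rewrite /act_ghost sf ?add0r; last by apply: contra nl; exact: normal_tail.
  by case: l nl => // -[//|h] l nl; rewrite (negbTE nl) andbF.
- by rewrite (IH _ sf)// oppr0.
- by rewrite (IHx _ sf)// (IHy _ sf)// addr0.
- by rewrite (IH _ sf)// mulr0.
- by rewrite (IHx _ (IHy _ sf)).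
Qed.

Lemma act_linear x a f1 f2 : act x (fun l z => a * f1 l z + f2 l z) =
  fun l z => a * act x f1 l z + act x f2 l z.
Proof.
elim: x f1 f2 => [v|e|e||x IH|x IHx y IHy|b x IH|x IHx y IHy] f1 f2;
  apply/funext => l; apply/funext => z /=.
- by case: ifP => // _; ring.
- rewrite /act_arrow; case: l => [|[h|h] l]; try by case: ifP => _; ring.
  case: ifP => _; first by case: ifP => _; ring.
  case: ifP => _; last by ring.
  case: l => [|[h'|h'] l]; try by ring.
  by case: ifP => _; ring.
- rewrite /act_ghost; case: l => [|[h|h] l]; try by ring.
  by case: ifP => _; ring.
- by ring.
- by rewrite IH; ring.
- by rewrite IHx IHy; ring.
- by rewrite IH; ring.
- by rewrite IHy IHx.
Qed.

Lemma actD x f1 f2 : act x (fun l z => f1 l z + f2 l z) =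
  fun l z => act x f1 l z + act x f2 l z.
Proof.
have := act_linear x 1 f1 f2; under eq_fun do under eq_fun do rewrite mul1r.
by move=> ->; apply/funext => l; apply/funext => z; rewrite mul1r.
Qed.

Lemma act0 x : act x (fun _ _ => 0) = fun _ _ => 0.
Proof.
have := act_linear x (-1) (fun _ _ => 0) (fun _ _ => 0).
under eq_fun do under eq_fun do rewrite mulr0 addr0.
by move=> ->; apply/funext => l; apply/funext => z; rewrite mulN1r addNr.
Qed.

Lemma actZ x a f : act x (fun l z => a * f l z) = fun l z => a * act x f l z.
Proof.
have := act_linear x a f (fun _ _ => 0); under eq_fun do under eq_fun do rewrite addr0.
by move=> ->; apply/funext => l; apply/funext => z; rewrite act0 addr0.
Qed.

Lemma act_sum (I : Type) (r : seq I) (P : pred I) (x : I -> lpa_expr k G) f l z :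
  act (\big[@EAdd k G/@EZero k G]_(i <- r | P i) x i) f l z = \sum_(i <- r | P i) act (x i) f l z.
Proof. by elim/big_rec2: _ => //= i y1 y2 _ <-. Qed.

Lemma supp_source f x l z : normal_supp f ->
  letter_target x != word_source l z -> f (x :: l) z = 0.
Proof. by move=> sf xl; rewrite sf// normal_cons (negbTE xl). Qed.

Lemma act_CK1 e h f : normal_supp f ->
  act (EMul (EGhost k e) (EArrow k h)) f =
  act (if e == h then EVert k (target e) else EZero k G) f.
Proof.
move=> sf; apply/funext => l; apply/funext => z /=; rewrite /act_ghost /= normal_cons.
have head_ghost g y : normal (inr g :: y) z ->
    act_arrow h f y z = if special h then f (inr h :: y) z else 0.
  by case: y => [|[g'|g'] y] //; rewrite normal_cons => /and3P[].
have f0 x : ~~ normal l z -> f (x :: l) z = 0.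
  by move=> nl; apply: sf; apply: contra nl; exact: normal_tail.
rewrite eq_sym; case: eqP => [he|/eqP he] /=.
- rewrite he in head_ghost *; rewrite [in RHS]eq_sym; case: eqP => [tl|tl]/=; last first.
    rewrite add0r; case: l tl {f0} => [|[g|g] l] //= tl.
    by case: eqP => // ge; rewrite ge in tl.
  have [nl|nl] := boolP (normal l z); last first.
    by rewrite andbF add0r (sf _ _ nl); case: l {tl f0 nl} => [|[g|g] l] //; rewrite andbF.
  case: l nl {tl f0} => [|[g|g] l] nl; rewrite ?addr0//= !andbT.
  rewrite eq_sym; case: eqP => [ge|_]; last by rewrite addr0.
  by rewrite (head_ghost _ _ nl); case: (special e); rewrite /= ?add0r ?addr0 ?ge.
- case: l f0 => [|[g|g] l] f0; rewrite ?if_same ?addr0//.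
  have [->|ge] := eqVneq g e; last by rewrite if_same addr0.
  have [nl|nl] := boolP (normal _ _); last first.
    rewrite addr0; case: ifP => // /andP[_ /eqP eh].
    rewrite sf ?oppr0//; apply: contra nl; rewrite !normal_cons /= eh.
    by case: l {f0} => [|[]].
  (* For special h two terms remain, the correction in [act_arrow] and the term of the ghost. They
     cancel if e and h have the same source; otherwise there is no correction and the other term
     vanishes, its word not being composable. *)
  rewrite (head_ghost _ _ nl) andTb; case: (special h) => //=; last by rewrite addr0.
  case: eqP => [_|eh]; first by rewrite addNr.
  rewrite supp_source ?addr0//=; move: nl; rewrite normal_cons => /and3P[/eqP /= <- _ _].
  by apply/eqP => eh'; apply: eh.
Qed.

Lemma act_CK2 v f : normal_supp f -> (exists e, source e = v) ->
  act (EVert k v) f =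
  act (\big[@EAdd k G/@EZero k G]_(e | source e == v) EMul (EArrow k e) (EGhost k e)) f.
Proof.
move=> sf [e0' <-{v}]; have [e0 sp0 <-{e0'}] := special_ex e0'.
have sp e : source e = source e0 -> special e = (e == e0).
  by move=> ee0; apply/idP/eqP => [se|-> //]; exact: special_inj ee0.
apply/funext => l; apply/funext => z; rewrite act_sum /=.
have fee y : f (inl e0 :: inr e0 :: y) z = 0.
  by rewrite sf// normal_cons /= sp// !eqxx.
have ghost_cons y : act_ghost e0 f (inr e0 :: y) z =
    if normal (inr e0 :: y) z then f y z else 0.
  by rewrite /act_ghost fee add0r eqxx.
case: l => [|[g|g] l].
- rewrite (bigD1 e0)//= sp// eqxx ghost_cons big1 ?addr0; last first.
    by move=> e /andP[/eqP ee0 ne]; rewrite sp// (negbTE ne).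
  by rewrite normal_cons /= !andbT eq_sym.
- rewrite /=; have [sg|sg] := eqVneq (source g) (source e0); last first.
    rewrite big1// => e /eqP ee0; have [ge|_] := eqVneq g e; first by rewrite ge ee0 eqxx in sg.
    by rewrite ee0 (negbTE sg) andbF.
  rewrite (bigD1 g) ?sg//= eqxx.
  (* On words beginning with g g^* for g other than [e0], two summands contribute: that of g yields
     the wanted coefficient plus the one of y, and the correction in that of [e0] takes the latter
     away. *)
  have [[y lE]|noret] := pselect (exists y, l = inr g :: y).
    rewrite lE; have [ge0|ge0] := eqVneq g e0.
      rewrite ge0 normal_cons /= sp// !eqxx /= add0r big1 ?fee// => e /andP[/eqP ee0 ne].
      by rewrite eq_sym (negbTE ne) sp// (negbTE ne).
    rewrite (bigD1 e0)/=; last by rewrite eqxx eq_sym.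
    rewrite (negbTE ge0) sp// !eqxx ghost_cons big1 ?addr0; last first.
      move=> e /andP[/andP[/eqP ee0 ne] ne0].
      by rewrite eq_sym (negbTE ne) sp// (negbTE ne0).
    have -> : normal [:: inl g, inr g & y] z = normal (inr g :: y) z.
      by rewrite normal_cons /= !eqxx sp// (negbTE ge0).
    have -> : normal (inr e0 :: y) z = normal (inr g :: y) z by rewrite !normal_cons /= sg.
    rewrite /act_ghost eqxx /=; have [_|ny] := boolP (normal (inr g :: y) z).
      by rewrite addrK.
    by rewrite oppr0 addr0 sf//; apply: contra ny; exact: normal_tail.
  rewrite big1 ?addr0; last first.
    move=> e /andP[/eqP ee0 ne]; rewrite eq_sym (negbTE ne); case: ifP => // _.
    case: l noret => [|[h|h] l] noret //.
    by case: eqP => // hg; case: noret; exists l; rewrite hg.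
  case: ifP => [nl|/negbT nl]; last by rewrite sf.
  rewrite /act_ghost; case: l noret nl => [|[h|h] l] noret nl; rewrite ?addr0//.
  by case: eqP => [hg|_]; [case: noret; exists l; rewrite hg|rewrite addr0].
- rewrite (bigD1 e0)//= sp// eqxx ghost_cons big1 ?addr0; last first.
    by move=> e /andP[/eqP ee0 ne]; rewrite sp// (negbTE ne).
  rewrite normal_cons /= eq_sym; case: eqP => //= _.
  by case: ifP => // /negbT; exact: sf.
Qed.

Lemma act_rel x y : lpa_rel x y -> forall f, normal_supp f -> act x f = act y f.
Proof.
have eqf (f1 f2 : seq letter -> vert G -> k) : (forall l z, f1 l z = f2 l z) -> f1 = f2.
  by move=> E; apply/funext => l; apply/funext => z.
elim=> {x y}.
- by [].
- by move=> x y _ IH f /IH ->.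
- by move=> x y z _ IH1 _ IH2 f sf; rewrite IH1// IH2.
- by move=> x x' _ IH f sf /=; rewrite IH.
- by move=> x x' y y' _ IHx _ IHy f sf /=; rewrite IHx// IHy.
- by move=> a x x' _ IH f sf /=; rewrite IH.
- by move=> x x' y y' _ IHx _ IHy f sf /=; rewrite IHx ?IHy//; exact: act_supp.
- by move=> x y z f sf; apply: eqf => l t /=; rewrite addrA.
- by move=> x y f sf; apply: eqf => l t /=; rewrite addrC.
- by move=> x f sf; apply: eqf => l t /=; rewrite add0r.
- by move=> x f sf; apply: eqf => l t /=; rewrite addNr.
- by move=> a b x f sf; apply: eqf => l t /=; rewrite mulrA.
- by move=> x f sf; apply: eqf => l t /=; rewrite mul1r.
- by move=> a x y f sf; apply: eqf => l t /=; rewrite mulrDr.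
- by move=> a b x f sf; apply: eqf => l t /=; rewrite mulrDl.
- by [].
- by [].
- by move=> x y z f sf; exact: actD.
- by [].
- by move=> a x y f sf; rewrite [RHS]actZ.
- move=> v w f sf; apply: eqf => l z /=.
  case: (eqVneq v w) => [->|vw] /=; first by case: (word_source l z == w).
  by case: eqP => // ->; rewrite (negbTE vw).
- move=> e f sf; apply: eqf => l z /=; case: eqP => // /eqP sl.
  case: l sl => [|[g|g] l] /= sl; rewrite /act_arrow.
  + by case: ifP => // se; rewrite supp_source //= eq_sym.
  + case: eqP => [ge|_]; first by rewrite ge eqxx in sl.
    by rewrite (negbTE sl) andbF.
  + by case: ifP => // se; rewrite supp_source //= eq_sym.
- move=> e f sf; apply: eqf => l z; rewrite /= /act_arrow.
  case: l => [|[g|g] l] /=; rewrite ?eqxx//.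
    case: eqP => [->|_].
      by rewrite normal_cons /= eq_sym; case: eqP.
  by case: l => [|[//|g'] l] //; rewrite /= eqxx.
- move=> e f sf; apply: eqf => l z /=; case: eqP => // /eqP sl.
  rewrite /act_ghost supp_source ?add0r//=; last by rewrite eq_sym.
  case: l sl => [|[g|g] l] //= sl.
  by case: eqP => // ge; rewrite ge eqxx in sl.
- move=> e f sf; apply: eqf => l z /=; rewrite /act_ghost /= eqxx; congr (_ + _).
  case: l => [|[g|g] l] //=.
  by case: eqP => // ->; rewrite normal_cons /= eq_sym; case: eqP.
- by move=> e h f sf; exact: act_CK1.
- by move=> v ve f sf; exact: act_CK2.
Qed.
End Representation.

(** * Coordinates of monomials and rewriting rules in the algebra *)

Section NormalForm.
Variables (k : comPzRingType) (G : digraph).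
Local Notation letter := (arrow G + arrow G)%type.
Local Notation word := (seq letter * vert G)%type.
Local Notation L := (leavitt k G).
Implicit Types (e g h : arrow G) (l : seq letter) (z v : vert G) (w : word).

Definition letter_expr (x : letter) : lpa_expr k G :=
  match x with inl e => EArrow k e | inr e => EGhost k e end.

Definition mono_expr l z : lpa_expr k G :=
  foldr (fun x y => EMul (letter_expr x) y) (EVert k z) l.

Definition gen (x : letter) : L := lpa_class (letter_expr x).
Definition mono l z : L := lpa_class (mono_expr l z).

(** The function acted upon is the coefficient function of the unit, the sum of all vertices; so the
    result is that of x * 1. *)
Definition normal_coef (x : L) l z : k := act (repr x) (fun l _ => (l == [::])%:R) l z.

Lemma normal_coef_class x l z :
  normal_coef (lpa_class x) l z = act x (fun l _ => (l == [::])%:R) l z.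
Proof.
rewrite /normal_coef (act_rel (lpa_reprP x))// => {l z} -[|y l]//=.
Qed.

Lemma normal_coefD x y l z : normal_coef (x + y) l z = normal_coef x l z + normal_coef y l z.
Proof.
elim/lpa_classW: x => x; elim/lpa_classW: y => y.
by rewrite -[_ + _]lpa_classD !normal_coef_class.
Qed.

Lemma normal_coefZ a x l z : normal_coef (a *: x) l z = a * normal_coef x l z.
Proof. by elim/lpa_classW: x => x; rewrite -[_ *: _]lpa_classZ !normal_coef_class. Qed.

Lemma normal_coef0 l z : normal_coef 0 l z = 0.
Proof. by rewrite -[0 : L](scale0r (0 : L)) normal_coefZ mul0r. Qed.

Lemma normal_coef_sum (I : Type) (r : seq I) (F : I -> L) l z :
  normal_coef (\sum_(i <- r) F i) l z = \sum_(i <- r) normal_coef (F i) l z.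
Proof.
by elim: r => [|i r IH]; rewrite ?big_nil ?normal_coef0// !big_cons normal_coefD IH.
Qed.

(** Building a normal word letter by letter never triggers a rewriting: the branches of the action
    that rewrite see a nonzero value only if the new letter and the head of [l] form a pair excluded
    by [red]. *)
Lemma normal_coef_mono l z l' z' : normal l z -> normal_coef (mono l z) l' z' = ((l', z') == (l, z))%:R.
Proof.
move=> nl; rewrite normal_coef_class.
have -> // : act (mono_expr l z) (fun l _ => (l == [::])%:R) =
             fun l' z' => ((l', z') == (l, z))%:R.
elim: l nl {l' z'} => [|x l IH] nl; apply/funext => l'; apply/funext => z' /=.
  by case: l' => [|y l'] /=; [rewrite xpair_eqE eqxx/=; case: eqP|rewrite if_same].
have := nl; rewrite normal_cons => /and3P[_ red nl'].
case: x nl red => [e|e] nl red; rewrite /= (IH nl').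
- case: l' => [|[h|h] l']; rewrite /act_arrow.
  + case: ifP => // se; rewrite xpair_eqE; case: eqP => // lE.
    by rewrite -lE /= se eqxx in red.
  + case: eqVneq => [->|he].
      case: ifP => [nl2|/negbT nl2].
        by rewrite !xpair_eqE eqseq_cons eqxx.
      by rewrite xpair_eqE; case: eqP => //= -[l'l]; case: eqP => //= z'z; rewrite l'l z'z nl in nl2.
    rewrite [RHS](_ : _ = 0); last by rewrite xpair_eqE eqseq_cons /= -[inl h == _]/(h == e) (negbTE he).
    case: ifP => // /andP[se _]; case: l' => [|[//|h'] l']//; case: eqP => // h'h.
    rewrite xpair_eqE; case: eqP => [lE|]; rewrite ?oppr0//.
    by rewrite -lE /= se eqxx in red.
  + case: ifP => // se; rewrite !xpair_eqE; case: eqP => // lE.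
    by rewrite -lE /= se eqxx in red.
- rewrite /act_ghost xpair_eqE; case: eqP => [lE|_] /=; first by rewrite -lE in red.
  rewrite add0r; case: l' => [|[h|h] l']//.
  rewrite !xpair_eqE eqseq_cons /= -[inr h == _]/(h == e).
  case: eqVneq => //= ->; case: ifP => // /negbT nl2.
  by case: eqP => //= l'l; case: eqP => //= z'z; rewrite l'l z'z nl in nl2.
Qed.

Lemma rel_class (x y : lpa_expr k G) : lpa_rel x y -> lpa_class x = lpa_class y :> L.
Proof. by move=> xy; apply/lpa_classP. Qed.

Lemma classM (x y : lpa_expr k G) : lpa_class (EMul x y) = lpa_class x * lpa_class y :> L.
Proof. exact: lpa_classM. Qed.

Lemma classD (x y : lpa_expr k G) : lpa_class (EAdd x y) = lpa_class x + lpa_class y :> L.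
Proof. exact: lpa_classD. Qed.

Lemma lpa_scaleM (a b : k) (x y : L) : (a *: x) * (b *: y) = (a * b) *: (x * y).
Proof.
rewrite -!lpa_inE rmorphM -!mulrA; congr (_ * _).
by rewrite !mulrA [lpa_in _ _ _ * _]lpa_in_comm.
Qed.

Lemma lpa_mul_scale (a : k) (x y : L) : x * (a *: y) = a *: (x * y).
Proof. by rewrite -[x in LHS]scale1r lpa_scaleM mul1r. Qed.

Lemma mono_cons x l z : mono (x :: l) z = gen x * mono l z.
Proof. exact: classM. Qed.

Lemma mulVV v z : lpa_vert k v * lpa_vert k z = if v == z then lpa_vert k v else 0.
Proof. by rewrite -[LHS]classM (rel_class (RV k v z)); case: eqP. Qed.

Lemma mulVgen x : lpa_vert k (letter_source x) * gen x = gen x.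
Proof.
rewrite -[LHS]classM; apply: rel_class.
by case: x => e; [exact: RE_source|exact: RE_ghost_source].
Qed.

Lemma mulgenV x : gen x * lpa_vert k (letter_target x) = gen x.
Proof.
rewrite -[LHS]classM; apply: rel_class.
by case: x => e; [exact: RE_target|exact: RE_ghost_target].
Qed.

Lemma mono0 z : mono [::] z = lpa_vert k z. Proof. by []. Qed.

Lemma mono1 x : mono [:: x] (letter_target x) = gen x.
Proof. by rewrite mono_cons mono0 mulgenV. Qed.

Lemma mulVmono v l z :
  lpa_vert k v * mono l z = if v == word_source l z then mono l z else 0.
Proof.
case: l => [|x l] /=; first by rewrite [LHS]mulVV; case: eqP => // ->.
rewrite mono_cons -{1}mulVgen -mulrA mulrA mulVV; case: eqP => [->|_]; last by rewrite mul0r.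
by rewrite mulrA mulVgen.
Qed.

Lemma mulgen_mono0 x l z : letter_target x != word_source l z -> gen x * mono l z = 0.
Proof. by move=> xl; rewrite -mulgenV -mulrA mulVmono (negbTE xl) mulr0. Qed.

Lemma mulVmono1 l z : lpa_vert k (word_source l z) * mono l z = mono l z.
Proof. by rewrite mulVmono eqxx. Qed.

Lemma mul_ghost_arrow e h : gen (inr e) * gen (inl h) = if e == h then lpa_vert k (target e) else 0.
Proof. by rewrite -[LHS]classM (rel_class (RCK1 k e h)); case: eqP. Qed.

Lemma mul_arrow_ghost e : gen (inl e) * gen (inr e) =
  lpa_vert k (source e) -
  \sum_(h | (source h == source e) && (h != e)) gen (inl h) * gen (inr h).
Proof.
apply/eqP; rewrite eq_sym subr_eq -(bigD1 (P := fun h => source h == source e) e)//=.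
apply/eqP; rewrite [LHS](rel_class (@RCK2 k G (source e) (ex_intro (fun h => source h = source e) e erefl))).
by elim/big_rec2: _ => // h x y _ <-; rewrite classD classM.
Qed.

Lemma mul_special e l z : word_source l z = source e ->
  gen (inl e) * mono (inr e :: l) z =
  mono l z - \sum_(h | (source h == source e) && (h != e)) mono (inl h :: inr h :: l) z.
Proof.
move=> ws; rewrite mono_cons mulrA mul_arrow_ghost mulrBl -ws mulVmono1 mulr_suml.
by congr (_ - _); apply: eq_bigr => h _; rewrite !mono_cons mulrA.
Qed.

End NormalForm.

(** * Spans of normal words with restricted coefficients *)

Section CoefficientSpans.
Variables (k : comPzRingType) (G : digraph).
Local Notation letter := (arrow G + arrow G)%type.
Local Notation word := (seq letter * vert G)%type.
Local Notation L := (leavitt k G).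
Local Notation mono := (@mono k G).
Local Notation gen := (@gen k G).
Implicit Types (e g h : arrow G) (l : seq letter) (z v : vert G) (w : word).
Implicit Types (U : set k) (m n : nat) (x y : L).

(** Only a subgroup is asked for, so that spans over the integers and over F-subspaces of [k] are
    treated alike. *)
Definition additive_set U := U 0 /\ forall a b, U a -> U b -> U (a - b).

Definition span_over U n : set L :=
  [set x | exists c : word -> k, (forall w, U (c w)) /\
     x = \sum_(w <- words G n) c w *: mono w.1 w.2].

Section Closure.
Variables (U : set k) (n : nat).
Hypothesis zU : additive_set U.

Lemma span_over0 : span_over U n 0.
Proof.
case: zU => U0 _; exists (fun=> 0); split => //.
by rewrite big1// => w _; rewrite scale0r.
Qed.

Lemma span_overB x y : span_over U n x -> span_over U n y -> span_over U n (x - y).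
Proof.
move=> [c [Uc ->]] [d [Ud ->]]; exists (fun w => c w - d w); split.
  by move=> w; apply: zU.2.
by rewrite -sumrB; apply: eq_bigr => w _; rewrite scalerBl.
Qed.

Lemma span_overD x y : span_over U n x -> span_over U n y -> span_over U n (x + y).
Proof.
move=> Ux Uy; rewrite -[y]opprK; apply: span_overB => //.
by rewrite -sub0r; apply: span_overB => //; exact: span_over0.
Qed.

Lemma span_over_sum (I : eqType) (s : seq I) (P : pred I) (F : I -> L) :
  (forall i, i \in s -> P i -> span_over U n (F i)) ->
  span_over U n (\sum_(i <- s | P i) F i).
Proof.
move=> UF; rewrite big_seq_cond; apply: big_ind => [||i /andP[si Pi]].
- exact: span_over0.
- exact: span_overD.
- exact: UF.
Qed.

Lemma span_over_mono a l z : U a -> normal l z -> (size l <= n)%N ->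
  span_over U n (a *: mono l z).
Proof.
move=> Ua nl sl; exists (fun w => if w == (l, z) then a else 0); split.
  by move=> w; case: ifP => // _; exact: zU.1.
rewrite (bigD1_seq (l, z)) ?uniq_words ?mem_words ?nl//= eqxx big1 ?addr0//.
by move=> w /negbTE ->; rewrite scale0r.
Qed.

End Closure.

Lemma span_over_sub U U' m n x : additive_set U' -> U `<=` U' -> (m <= n)%N ->
  span_over U m x -> span_over U' n x.
Proof.
move=> zU' UU' mn [c [Uc ->]]; apply: span_over_sum => // -[l z].
rewrite mem_words => /andP[nl sl] _; apply: span_over_mono => //.
  exact/UU'/Uc.
exact: leq_trans mn.
Qed.

Lemma span_over_scale U U' n a x : (forall b, U b -> U' (a * b)) ->
  span_over U n x -> span_over U' n (a *: x).
Proof.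
move=> UU' [c [Uc ->]]; exists (fun w => a * c w); split; first by move=> w; exact: UU'.
by rewrite scaler_sumr; apply: eq_bigr => w _; rewrite scalerA.
Qed.

Definition int_scalars : set k := [set a | exists i : int, a = i%:~R].

Lemma additive_int_scalars : additive_set int_scalars.
Proof.
split; first by exists 0.
by move=> _ _ [i ->] [j ->]; exists (i - j); rewrite intrD mulrNz.
Qed.

Lemma int_scalars1 : int_scalars 1. Proof. by exists 1. Qed.

Lemma additive_int_scalar U a i : additive_set U -> U a -> U (a * i%:~R).
Proof.
move=> [U0 UB] Ua; have UN b : U b -> U (- b) by move=> Ub; rewrite -sub0r; apply: UB.
have Un n : U (a * n%:R).
  elim: n => [|n IH]; first by rewrite mulr0.
  by rewrite -natr1 mulrDr mulr1 -[a in _ + a]opprK; apply: UB => //; exact: UN.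
case: (intP i) => [|n|n]; first by rewrite mulr0.
  exact: Un.
by rewrite mulrNz mulrN; apply/UN/Un.
Qed.

Local Notation int_span := (span_over int_scalars).

Lemma int_span_mono n l z : normal l z -> (size l <= n)%N -> int_span n (mono l z).
Proof.
move=> nl sl; rewrite -[mono l z]scale1r; apply: span_over_mono => //.
  exact: additive_int_scalars.
exact: int_scalars1.
Qed.

Lemma int_span_linear (f : L -> L) n n' : zmod_morphism f -> scalable f ->
  (forall l z, normal l z -> (size l <= n)%N -> int_span n' (f (mono l z))) ->
  forall x, int_span n x -> int_span n' (f x).
Proof.
move=> fB fZ H x [c [Uc ->]].
have f0 : f 0 = 0 by rewrite -[X in f X](subrr 0) fB subrr.
have fD a b : f (a + b) = f a + f b.
  have fN : f (- b) = - f b by rewrite -[- b]sub0r fB f0 sub0r.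
  by rewrite -[in LHS](opprK b) fB fN opprK.
have fS (s : seq word) : f (\sum_(w <- s) c w *: mono w.1 w.2) =
    \sum_(w <- s) c w *: f (mono w.1 w.2).
  by elim: s => [|w s IH]; rewrite ?big_nil ?f0// !big_cons fD fZ IH.
rewrite fS; apply: span_over_sum; first exact: additive_int_scalars.
move=> [l z]; rewrite mem_words => /andP[nl sl] _.
apply: (@span_over_scale int_scalars); last exact: H.
have [i ->] := Uc (l, z); move=> _ [j ->].
by exists (i * j); rewrite intrM.
Qed.

(** One rewriting is enough. A ghost meeting an arrow cancels or gives 0. A special e meeting its
    ghost gives a shorter word and words h h^* l that are only one letter longer than e^* l; these
    are normal because h, sharing the source of e, is not special. *)
Lemma int_span_gen (x : letter) n y : int_span n y -> int_span n.+1 (gen x * y).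
Proof.
apply: int_span_linear.
- by move=> a b; rewrite mulrBr.
- by move=> a b; exact: lpa_mul_scale.
move=> l z nl sl; have [xl|xl] := eqVneq (letter_target x) (word_source l z); last first.
  by rewrite mulgen_mono0//; apply/span_over0/additive_int_scalars.
have [red|] := boolP (if l is y :: _ then reduced_pair x y else true).
  by rewrite -mono_cons; apply: int_span_mono; rewrite ?normal_cons ?xl ?eqxx ?red.
case: l nl sl xl => //= y' l nl sl xl.
case: x xl => e xl; case: y' nl sl xl => h nl sl xl //= red.
  move: red; rewrite negbK => /andP[/eqP eh se]; rewrite -eh in nl xl *.
  move: nl; rewrite normal_cons /= => /and3P[/eqP el red nl].
  rewrite mul_special//; apply: span_overB; first exact: additive_int_scalars.
    by apply: int_span_mono => //; lia.
  apply: span_over_sum; first exact: additive_int_scalars.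
  move=> g _ /andP[/eqP ge gne]; apply: int_span_mono => //.
  rewrite !normal_cons /= !eqxx ge el eqxx nl !andbT/=.
  rewrite red andbT; apply: contra gne => sg; apply/eqP; exact: special_inj sg se ge.
rewrite mono_cons mulrA mul_ghost_arrow; case: eqP => [eh|_]; last first.
  by rewrite mul0r; apply/span_over0/additive_int_scalars.
move: nl; rewrite normal_cons => /and3P[/eqP /= hl _ nl].
by rewrite eh hl mulVmono1; apply: int_span_mono => //; lia.
Qed.

Lemma int_span_mono_mul l z n y : int_span n y -> int_span (size l + n) (mono l z * y).
Proof.
move=> ny; elim: l => [|x l IH] /=; last first.
  by rewrite mono_cons -mulrA addSn; exact: int_span_gen.
move: y ny; apply: int_span_linear.
- by move=> a b; rewrite mulrBr.
- by move=> a b; exact: lpa_mul_scale.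
move=> l z' nl sl; rewrite [mono _ _]/(lpa_vert k z) mulVmono.
case: ifP => _; last by apply/span_over0/additive_int_scalars.
exact: int_span_mono.
Qed.

(** This is where integrality counts: reducing a product of two words multiplies the coefficient a b
    by integers only, and these preserve the subgroup [U'']. *)
Lemma span_over_mul (U U' U'' : set k) m n x y : additive_set U'' ->
  (forall a b, U a -> U' b -> U'' (a * b)) ->
  span_over U m x -> span_over U' n y -> span_over U'' (m + n) (x * y).
Proof.
move=> zU UU [c [Uc ->]] [d [Ud ->]].
rewrite mulr_suml; apply: span_over_sum => // -[l z]; rewrite mem_words => /andP[nl sl] _.
rewrite mulr_sumr; apply: span_over_sum => // -[l' z']; rewrite mem_words => /andP[nl' sl'] _.
rewrite lpa_scaleM.
apply: (@span_over_scale int_scalars).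
  by move=> _ [i ->]; apply: additive_int_scalar => //; exact: UU.
apply: (@span_over_sub int_scalars _ (size l + n)) => //; first exact: additive_int_scalars.
  by rewrite leq_add2r.
exact/int_span_mono_mul/int_span_mono.
Qed.

Lemma span_over_exhaust x : exists n, span_over setT n x.
Proof.
have mW m n y : (m <= n)%N -> span_over setT m y -> span_over setT n y.
  by move=> mn; exact: span_over_sub.
have iT n y : int_span n y -> span_over setT n y by exact: span_over_sub.
have genT (y : letter) : span_over setT 1 (gen y).
  rewrite -(mono1 k y); apply/iT/int_span_mono => //.
  by rewrite normal_cons eqxx.
elim/lpa_classW: x; elim=> [v|e|e||x [n xn]|x [m xm] y [n yn]|a x [n xn]|x [m xm] y [n yn]].
- by exists 0; apply/iT/(@int_span_mono 0 [::] v).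
- by exists 1; exact: (genT (inl e)).
- by exists 1; exact: (genT (inr e)).
- by exists 0; exact: span_over0.
- exists n; have -> : lpa_class (EOpp x) = 0 - lpa_class x :> L.
    by rewrite sub0r; exact: lpa_classN.
  by apply: span_overB => //; exact: span_over0.
- exists (maxn m n); rewrite classD; apply: span_overD => //.
    by apply: mW xm; exact: leq_maxl.
  by apply: mW yn; exact: leq_maxr.
- exists n; rewrite lpa_classZ; exact: span_over_scale xn.
- by exists (m + n)%N; rewrite classM; exact: span_over_mul xm yn.
Qed.

End CoefficientSpans.

(** * Upper limits, dimensions and growth exponents *)

Section UpperLimits.
Variable R : realType.
Implicit Types (u v : nat -> \bar R) (n N : nat).
Local Open Scope ereal_scope.

Lemma limn_esup_le u N b : (forall n, (N <= n)%N -> u n <= b) -> limn_esup u <= b.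
Proof.
move=> ub; apply: (@le_trans _ _ (ereal_sup (u @` [set n | (N <= n)%N]))).
  by apply: ereal_inf_lbound; exists [set n | (N <= n)%N] => //; exact: nbhs_infty_ge.
by apply: ge_ereal_sup => _ [n Nn <-]; exact: ub.
Qed.

Lemma limn_esup_lt u b : limn_esup u < b ->
  exists N, forall n, (N <= n)%N -> u n < b.
Proof.
move=> /ereal_inf_lt[_ [V [N _ NV] <-] ub]; exists N => n Nn.
apply: le_lt_trans ub; apply: ereal_sup_ubound; exists n => //; exact: NV.
Qed.

Lemma limn_esup_ge0 u : (forall n, 0 <= u n) -> 0 <= limn_esup u.
Proof.
move=> u0; rewrite leNgt; apply/negP => /limn_esup_lt[N /(_ _ (leqnn N))].
by rewrite ltNge u0.
Qed.

Lemma ln_nat_large (r : R) : exists N, forall n, (N <= n)%N -> (r < ln n%:R)%R.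
Proof.
exists (Num.truncn (expR r)).+1 => n Nn.
have rn : (expR r < n%:R)%R.
  by apply: lt_le_trans (truncnS_gt _) _; rewrite ler_nat.
by rewrite -[r]expRK ltr_ln ?posrE ?expR_gt0//; apply: lt_trans rn; exact: expR_gt0.
Qed.

(** A constant factor in a dimension estimate turns into a term C / ln n, which disappears in the
    limit. Nonnegativity of [v] keeps its upper limit away from -oo. *)
Lemma limn_esup_shift u v (d C : R) : (forall n, 0 <= v n) ->
  (forall n, (1 < n)%N -> u n <= v n + (d + C / ln n%:R)%:E) ->
  limn_esup u <= limn_esup v + d%:E.
Proof.
move=> v0 uv; have := limn_esup_ge0 v0.
case vr : (limn_esup v) => [r| |]//= r0; last by rewrite addye ?leey.
apply/lee_addgt0Pr => e e0.
have [N1 vN] : exists N, forall n, (N <= n)%N -> v n < (r + e / 2)%:E.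
  by apply: limn_esup_lt; rewrite vr lte_fin ltrDl divr_gt0.
(* The bound 0 makes ln n positive, the other one makes C / ln n at most e / 2. *)
have [N2 lnN] := ln_nat_large (Num.max 0 (2 * C / e))%R.
apply: (@limn_esup_le _ (maxn N1 (maxn N2 2))) => n.
rewrite !geq_max => /and3P[n1 n2 n3].
apply: le_trans (uv _ n3) _; apply: le_trans (leeD2r _ (ltW (vN _ n1))) _.
rewrite -!EFinD lee_fin; have := lnN _ n2; rewrite gt_max => /andP[ln0 lnC].
have : (C / ln n%:R <= e / 2)%R.
  rewrite ler_pdivrMr//; move: lnC; rewrite ltr_pdivrMr// => /ltW; nra.
by lra.
Qed.

End UpperLimits.

(** * From bounds on dimensions to bounds on their logarithms *)

Section LogTerms.
Variable R : realType.
Implicit Types (x : \bar R) (n p q c d : nat).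

Lemma ln_nat_ge0 n : 0 <= ln (n%:R : R).
Proof. by case: n => [|n]; [rewrite ln0|apply: ln_ge0; rewrite ler1n]. Qed.

Lemma ln_nat_gt0 n : (1 < n)%N -> 0 < ln (n%:R : R).
Proof. by move=> n1; apply: ln_gt0; rewrite ltr1n. Qed.

Lemma lne_term_le x n p c d : (1 < n)%N -> (0 < p)%N -> (0 < c)%N -> (0 <= x)%E ->
  (x <= (p * (c * n ^ d))%:R%:E)%E ->
  (lne x * ((ln n%:R)^-1)%:E <=
   lne p%:R%:E * ((ln n%:R)^-1)%:E + (d%:R + ln c%:R / ln n%:R)%:E)%E.
Proof.
move=> n1 p0 c0 x0 xle; have ln0 := ln_nat_gt0 n1.
have pos m : (0 < m)%N -> (m%:R : R) \is Num.pos by move=> m0; rewrite posrE ltr0n.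
have n0 : (0 < n)%N by exact: ltnW.
apply: (@le_trans _ _ (lne (p * (c * n ^ d))%:R%:E * ((ln n%:R)^-1)%:E)%E).
  apply: lee_wpmul2r; first by rewrite lee_fin invr_ge0 ltW.
  by rewrite lee_lne// in_itv/= ?x0 ?lee_fin ?ler0n ?leey.
rewrite !lne_EFin ?ltr0n ?muln_gt0 ?p0 ?c0 ?expn_gt0 ?n0// -!EFinM -EFinD lee_fin.
rewrite !natrM natrX !lnM ?lnXn ?posrE ?mulr_gt0 ?exprn_gt0 ?ltr0n// !mulrDl.
have -> : ln (n%:R : R) *+ d / ln n%:R = d%:R by rewrite -[ln _ *+ d]mulr_natl mulfK ?gt_eqF.
by lra.
Qed.

Lemma lne_term_ge x n p q c d : (1 < n)%N -> (0 < p)%N -> (0 < q)%N ->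
  (n ^ d <= c * q)%N -> ((p * q)%:R%:E <= x)%E ->
  (lne p%:R%:E * ((ln n%:R)^-1)%:E <=
   lne x * ((ln n%:R)^-1)%:E + (- d%:R + ln c%:R / ln n%:R)%:E)%E.
Proof.
move=> n1 p0 q0 nq; have ln0 := ln_nat_gt0 n1.
have n0 : (0 < n)%N by exact: ltnW.
have c0 : (0 < c)%N by case: c nq => //; rewrite mul0n leqn0 expn_eq0 eqn0Ngt n0.
case: x => [r| |] // pqr; last by rewrite gt0_mulye ?lte_fin ?invr_gt0// addye// leey.
rewrite lee_fin in pqr.
have r0 : 0 < r by apply: lt_le_trans pqr; rewrite ltr0n muln_gt0 p0.
rewrite !lne_EFin ?ltr0n// -!EFinM -EFinD lee_fin.
have : ln p%:R + d%:R * ln n%:R <= ln r + ln c%:R.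
  rewrite mulr_natl -lnXn ?ltr0n// -!lnM ?posrE ?exprn_gt0 ?ltr0n//.
  rewrite ler_ln ?posrE ?mulr_gt0 ?exprn_gt0 ?ltr0n//.
  apply: (@le_trans _ _ ((p * q)%:R * c%:R)); last by rewrite ler_pM2r ?ltr0n.
  by rewrite -natrX -!natrM ler_nat -mulnA leq_mul2l mulnC nq orbT.
move=> le; rewrite -(ler_pM2r ln0) !mulrDl !mulfVK ?gt_eqF//; lra.
Qed.

End LogTerms.

(** * Subspaces, dimensions and GKdim over a possibly zero algebra *)

Section LinearAlgebra.
Variables (R : realType) (F : fieldType) (A : pzRingType) (phi : {rmorphism F -> A}).
Implicit Types (U W X : set A) (x y : A) (a : F).
Local Notation lin_span := (lin_span phi).
Local Notation lin_dim := (lin_dim R phi).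
Local Notation lin_indep := (lin_indep phi).

Definition is_subspace U := U 0 /\ forall a x y, U x -> U y -> U (phi a * x + y).

Lemma subspace_sum U (I : Type) (r : seq I) (P : pred I) (c : I -> F) (f : I -> A) :
  is_subspace U -> (forall i, P i -> U (f i)) -> U (\sum_(i <- r | P i) phi (c i) * f i).
Proof.
move=> [U0 UP] Uf; elim/big_rec: _ => // i x Pi Ux.
by apply: UP => //; exact: Uf.
Qed.

Lemma subspaceB U x y : is_subspace U -> U x -> U y -> U (x - y).
Proof.
by move=> [_ UP] Ux Uy; rewrite addrC -mulN1r -(rmorph1 phi) -rmorphN; exact: UP.
Qed.

Lemma subspaceZ U a x : is_subspace U -> U x -> U (phi a * x).
Proof. by move=> [U0 UP] Ux; rewrite -[_ * _]addr0; exact: UP. Qed.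

Lemma lin_span_sub X U : is_subspace U -> X `<=` U -> lin_span X `<=` U.
Proof. by move=> sU XU y [n [c [x [Xx ->]]]]; apply: subspace_sum => // i _; exact/XU. Qed.

Lemma sub_lin_span X : X `<=` lin_span X.
Proof.
move=> x Xx; exists 1%N, (fun=> 1), (fun=> x); split => //.
by rewrite big_ord1 rmorph1 mul1r.
Qed.

Lemma subspace_lin_span X : is_subspace (lin_span X).
Proof.
split.
  exists 0%N, (fun=> 0), (fun=> 0); split; first by case.
  by rewrite big_ord0.
move=> a _ _ [m [c [x [Xx ->]]]] [n [d [y [Xy ->]]]].
exists (m + n)%N, (fun i => match fintype.split i with inl i => a * c i | inr i => d i end),
  (fun i => match fintype.split i with inl i => x i | inr i => y i end); split.
  by move=> i; case: (fintype.split i).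
rewrite big_split_ord/= mulr_sumr; congr (_ + _); apply: eq_bigr => i _.
  by rewrite (unsplitK (inl i : 'I_m + 'I_n)%type) rmorphM mulrA.
by rewrite (unsplitK (inr i : 'I_m + 'I_n)%type).
Qed.

Lemma lin_span_seq (s : seq A) y : lin_span [set` s] y ->
  exists c : 'I_(size s) -> F, y = \sum_i phi (c i) * s`_i.
Proof.
apply: (@lin_span_sub _ [set y | exists c : 'I_(size s) -> F, y = \sum_i phi (c i) * s`_i]).
  split; first by exists (fun=> 0); rewrite big1// => i _; rewrite rmorph0 mul0r.
  move=> a _ _ [c ->] [d ->]; exists (fun i => a * c i + d i).
  rewrite mulr_sumr -big_split/=; apply: eq_bigr => i _.
  by rewrite rmorphD rmorphM mulrDl mulrA.
move=> x /= xs; have xi : (index x s < size s)%N by rewrite index_mem.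
exists (fun i => (i == Ordinal xi)%:R); rewrite (bigD1 (Ordinal xi))//= eqxx rmorph1 mul1r nth_index//.
by rewrite big1 ?addr0// => i /negbTE ->; rewrite rmorph0 mul0r.
Qed.

(* More vectors than generators: the coefficient matrix has a left kernel. *)
Lemma indep_leq_size n m (v : 'I_n -> A) (u : 'I_m -> A) : lin_indep v ->
  (forall i, exists c : 'I_m -> F, v i = \sum_j phi (c j) * u j) -> (n <= m)%N.
Proof.
move=> vi /choice[c vE]; rewrite leqNgt; apply/negP => mn.
pose M := \matrix_(i < n, j < m) c i j.
have kM : kermx M != 0.
  by rewrite -mxrank_eq0 mxrank_ker -lt0n subn_gt0 (leq_ltn_trans (rank_leq_col M)).
have [i rowi] : exists i, row i (kermx M) != 0.
  apply: contrapT => /forallNP h; move/negP: kM; apply; apply/eqP/row_matrixP => i.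
  by rewrite row0; apply/eqP/negPn/negP => /h.
pose d := row i (kermx M).
have dM : d *m M = 0 by rewrite /d -row_mul mulmx_ker row0.
move/negP: rowi; apply; apply/eqP/rowP => j; rewrite [RHS]mxE.
apply: (vi (fun j => d 0 j)).
under eq_bigr => j' _ do rewrite vE mulr_sumr.
rewrite exchange_big/= big1// => j' _.
under eq_bigr => i' _ do rewrite mulrA -rmorphM.
rewrite -mulr_suml -rmorph_sum/=.
have := congr1 (fun N : 'rV_m => N 0 j') dM; rewrite !mxE => dM0.
rewrite (_ : \sum_i0 _ = 0) ?rmorph0 ?mul0r//.
by rewrite -[RHS]dM0; apply: eq_bigr => i' _; rewrite !mxE.
Qed.

Lemma lin_dim_le U (I : finType) (u : I -> A) :
  (forall x, U x -> exists c : I -> F, x = \sum_i phi (c i) * u i) ->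
  (lin_dim U <= #|I|%:R%:E)%E.
Proof.
move=> Uu; apply: ge_ereal_sup => _ [n [v [Uv vi]] <-].
rewrite lee_fin ler_nat; apply: (indep_leq_size (u := u \o enum_val)) vi _ => i.
have [c ->] := Uu _ (Uv i); exists (c \o enum_val).
by rewrite (reindex (@enum_val I I))//; apply: onW_bij; exact: enum_val_bij.
Qed.

Lemma lin_dim_ge U (I : finType) (v : I -> A) : (forall i, U (v i)) ->
  (forall c : I -> F, \sum_i phi (c i) * v i = 0 -> forall i, c i = 0) ->
  (#|I|%:R%:E <= lin_dim U)%E.
Proof.
move=> Uv vi; apply: ereal_sup_ubound; exists #|I| => //.
exists (fun i => v (enum_val i)); split => // c cv i.
rewrite -(enum_valK i); apply: (vi (fun j => c (enum_rank j))).
rewrite (reindex (@enum_val I I)) /=; last by apply: onW_bij; exact: enum_val_bij.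
by rewrite -[RHS]cv; apply: eq_bigr => j _; rewrite enum_valK.
Qed.

(** An independent family of maximal size, which exists because sizes are bounded by that of [s],
    spans U and attains the supremum defining the dimension. *)
Lemma lin_basis U (s : seq A) : is_subspace U -> U `<=` lin_span [set` s] ->
  exists p (b : 'I_p -> A), [/\ forall i, U (b i), lin_indep b,
    forall x, U x -> exists c : 'I_p -> F, x = \sum_i phi (c i) * b i &
    lin_dim U = p%:R%:E].
Proof.
move=> sU Us; pose P p := `[< exists b : 'I_p -> A, (forall i, U (b i)) /\ lin_indep b >].
have exP : exists p, P p by exists 0%N; apply/asboolP; exists (fun=> 0); split => [[]//|c _ []].
have bP p : P p -> (p <= size s)%N.
  move=> /asboolP[b [Ub bi]]; apply: (indep_leq_size (u := fun i => s`_i) bi) => i.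
  exact/lin_span_seq/Us.
case: (ex_maxnP exP bP) => p /asboolP[b [Ub bi]] pmax; exists p, b.
have span x : U x -> exists c : 'I_p -> F, x = \sum_i phi (c i) * b i.
  move=> Ux; pose b' (i : 'I_p.+1) := oapp b x (unlift ord_max i).
  have [c [c0 [i ci]]] : exists c : 'I_p.+1 -> F,
      \sum_i phi (c i) * b' i = 0 /\ exists i, c i <> 0.
    apply: contrapT => h; have /pmax : P p.+1; last by rewrite ltnn.
    apply/asboolP; exists b'; split.
      by move=> i; rewrite /b'; case: unlift.
    move=> c c0 i; apply: contrapT => ci; apply: h; exists c; split => //.
    by exists i.
  have b'max : b' ord_max = x by rewrite /b' unlift_none.
  have b'lift j : b' (lift ord_max j) = b j by rewrite /b' liftK.
  have [cmax|cmax] := eqVneq (c ord_max) 0.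
    case: ci; case: (unliftP ord_max i) => [j|] -> //.
    apply: (bi (fun j => c (lift ord_max j))).
    rewrite -[RHS]c0 [RHS](bigD1_ord ord_max)//= cmax rmorph0 mul0r add0r.
    by apply: eq_bigr => j' _; rewrite b'lift.
  exists (fun j => - (c ord_max)^-1 * c (lift ord_max j)).
  have := c0; rewrite (bigD1_ord ord_max)//= b'max => /eqP.
  rewrite addr_eq0 => /eqP /(congr1 ( *%R (phi (c ord_max)^-1))).
  rewrite mulrA -rmorphM mulVf// rmorph1 mul1r => ->.
  rewrite mulrN mulr_sumr -sumrN; apply: eq_bigr => j _.
  by rewrite b'lift rmorphM rmorphN mulNr mulrA mulNr.
split => //; apply/eqP; rewrite eq_le.
by have := lin_dim_le span; have := @lin_dim_ge U 'I_p b Ub bi; rewrite card_ord => -> ->.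
Qed.

Lemma subalg_gen_lin_span (s : seq A) :
  subalg_gen phi (lin_span [set` s]) = subalg_gen phi [set` s].
Proof.
apply/seteqP; split; apply: smallest_sub.
- split.
  + by move=> B [[]].
  + by move=> a x y Bx By B [BU sB]; case: (BU) => _ h _; apply: h; [exact: Bx|exact: By].
  + by move=> x y Bx By B [BU sB]; case: (BU) => _ _ h; apply: h; [exact: Bx|exact: By].
- move=> x xs B [[B1 BD BM] sB]; apply: (lin_span_sub _ sB xs); split => //.
  by have := BD (-1) 1 1 B1 B1; rewrite rmorphN1 mulN1r addNr.
- split.
  + by move=> B [[]].
  + by move=> a x y Bx By B [BU sB]; case: (BU) => _ h _; apply: h; [exact: Bx|exact: By].
  + by move=> x y Bx By B [BU sB]; case: (BU) => _ _ h; apply: h; [exact: Bx|exact: By].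
- by move=> x xs B [BU sB]; apply: sB; exact: sub_lin_span.
Qed.

(** With [GKdim_le], this presents [GKdim] as one supremum over the finite-dimensional W containing
    1, so that estimates need not mention subalgebras. *)
Lemma GKdim_ge W : fin_dim_subspace phi W -> W 1 ->
  (growth_exponent R phi W <= GKdim R phi)%E.
Proof.
move=> [s Ws] W1; apply: (@le_trans _ _ (GKdim_fin_gen R phi (subalg_gen phi W))).
  by apply: ereal_sup_ubound; exists W => //; split => //; exists s.
apply: ereal_sup_ubound; exists (subalg_gen phi W) => //.
by exists s; rewrite Ws subalg_gen_lin_span.
Qed.

Lemma GKdim_le (b : \bar R) : (forall W, fin_dim_subspace phi W -> W 1 ->
  (growth_exponent R phi W <= b)%E) -> (GKdim R phi <= b)%E.
Proof.
move=> H; apply: ge_ereal_sup => _ [B _ <-]; apply: ge_ereal_sup => _ [W [fW W1 _] <-].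
exact: H.
Qed.

Section Powers.
Hypothesis cphi : central_map phi.

Lemma lin_span_mul X Y x y : lin_span X x -> lin_span Y y ->
  lin_span [set x' * y' | x' in X & y' in Y] (x * y).
Proof.
pose XY : set A := [set x' * y' | x' in X & y' in Y]; have sXY := subspace_lin_span XY.
have Xy (b : A) : Y b -> forall a : A, lin_span X a -> lin_span XY (a * b).
  move=> Yb; apply: (@lin_span_sub _ [set a : A | lin_span XY (a * b)]).
    split=> [/=|c a a' /= ab a'b]; first by rewrite mul0r; exact: sXY.1.
    by rewrite mulrDl -mulrA; exact: sXY.2.
  by move=> a Xa; apply: sub_lin_span; exists a => //; exists b.
move=> Xx; move: y; apply: (@lin_span_sub _ [set b : A | lin_span XY (x * b)]).
  split=> [/=|c a a' /= ab a'b]; first by rewrite mulr0; exact: sXY.1.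
  by rewrite mulrDr mulrA -cphi -mulrA; exact: sXY.2.
by move=> b Yb; exact: Xy.
Qed.

Lemma subspace_powS W n x y : W x -> subspace_pow phi W n y -> subspace_pow phi W n.+1 (x * y).
Proof.
move=> Wx; move: y; apply: (@lin_span_sub _ [set y | subspace_pow phi W n.+1 (x * y)]).
  have sW := subspace_lin_span
    [set \prod_(i < n.+1) x i | x in [set x : 'I_n.+1 -> A | forall i, W (x i)]].
  split=> [/=|c a a' /= xa xa']; first by rewrite mulr0; exact: sW.1.
  by rewrite mulrDr mulrA -cphi -mulrA; exact: sW.2.
move=> _ [t Wt <-]; apply: sub_lin_span; exists (fun i => oapp t x (unlift ord0 i)).
  by move=> i; case: unlift.
rewrite big_ord_recl unlift_none /=; congr (_ * _); apply: eq_bigr => i _.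
by rewrite liftK.
Qed.

Lemma subspace_pow1 W n : W 1 -> subspace_pow phi W n 1.
Proof. by move=> W1; apply: sub_lin_span; exists (fun=> 1) => //; rewrite big1. Qed.

Lemma subspace_pow_fin W n : fin_dim_subspace phi W ->
  exists s : seq A, subspace_pow phi W n `<=` lin_span [set` s].
Proof.
move=> [s Ws]; suff [t tP] : exists t : seq A, forall x : 'I_n -> A, (forall i, W (x i)) ->
    lin_span [set` t] (\prod_i x i).
  exists t; apply: lin_span_sub; first exact: subspace_lin_span.
  by move=> _ [x Wx <-]; exact: tP.
elim: n => [|n [t IH]].
  exists [:: 1] => x _; rewrite big_ord0; apply: sub_lin_span; exact: mem_head.
exists [seq x' * y' | x' <- s, y' <- t] => x Wx; rewrite big_ord_recl.
have Wx0 : lin_span [set` s] (x ord0) by rewrite -Ws.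
have := lin_span_mul Wx0 (IH _ (fun i => Wx (lift ord0 i))).
apply: lin_span_sub; first exact: subspace_lin_span.
move=> _ [a sa [b tb <-]]; apply: sub_lin_span; exact: allpairs_f.
Qed.

End Powers.

Lemma growth_term_ge0 W n : (1 <= lin_dim (subspace_pow phi W n))%E ->
  (0 <= lne (lin_dim (subspace_pow phi W n)) * ((ln n%:R)^-1)%:E)%E.
Proof.
move=> d1; apply: mule_ge0; last by rewrite lee_fin invr_ge0 ln_nat_ge0.
by rewrite lne_ge0.
Qed.

Lemma lin_dim_ge1 U : 1 <> 0 :> A -> U 1 -> (1 <= lin_dim U)%E.
Proof.
move=> A1 U1; have := @lin_dim_ge U 'I_1 (fun=> 1) (fun=> U1).
rewrite card_ord; apply=> c + i; rewrite big_ord1 mulr1 (ord1 i) => cU.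
apply/eqP/negPn/negP => c0; apply: A1.
by rewrite -(rmorph1 phi) -(mulVf c0) rmorphM cU mulr0.
Qed.

Lemma GKdim_ge0 : 1 <> 0 :> A -> (0 <= GKdim R phi)%E.
Proof.
move=> A1; apply: (@le_trans _ _ (growth_exponent R phi (lin_span [set` [:: 1]]))).
  apply: limn_esup_ge0 => n; apply/growth_term_ge0/lin_dim_ge1 => //.
  by apply: subspace_pow1; apply: sub_lin_span; exact: mem_head.
apply: GKdim_ge; first by exists [:: 1].
by apply: sub_lin_span; exact: mem_head.
Qed.

Lemma GKdim_trivial : 1 = 0 :> A -> GKdim R phi = -oo%E.
Proof.
move=> A0; apply/eqP; rewrite -leeNy_eq; apply: GKdim_le => W _ _.
(* From n = 2 on the factor 1 / ln n is positive, so the product with [lne 0] is -oo and not 0. *)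
apply: (@limn_esup_le _ _ 2) => n n2.
have dle : (lin_dim (subspace_pow phi W n) <= 0)%E.
  have := @lin_dim_le (subspace_pow phi W n) 'I_0 (fun=> 0); rewrite card_ord; apply.
  move=> x _; exists (fun=> 0); rewrite big_ord0.
  by rewrite -[x]mul1r A0 mul0r.
rewrite (le0_lneNy dle) mulNyr gtr0_sg ?mul1e// invr_gt0; exact: ln_nat_gt0.
Qed.

End LinearAlgebra.

Lemma GKdim_id (R : realType) (F : fieldType) (phi : {rmorphism F -> F}) :
  phi =1 id -> GKdim R phi = 0%E.
Proof.
move=> phiE; apply/eqP; rewrite eq_le; apply/andP; split; last first.
  by apply: GKdim_ge0; exact/eqP/oner_neq0.
apply: GKdim_le => W _ W1; apply: (@limn_esup_le _ _ 0) => n _.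
apply: mule_le0_ge0; last by rewrite lee_fin invr_ge0 ln_nat_ge0.
rewrite lne_le0; have := @lin_dim_le R _ _ phi (subspace_pow phi W n) 'I_1 (fun=> 1).
rewrite card_ord; apply=> x _; exists (fun=> x).
by rewrite big_ord1 phiE mulr1.
Qed.

(** * Growth of Leavitt path algebras under extension of scalars *)

Section ScalarExtension.
Variables (R : realType) (F : fieldType) (k : comPzRingType).
Variables (phi : {rmorphism F -> k}) (G : digraph).
Variable psi : {rmorphism F -> leavitt k G}.
Hypothesis psiE : forall a, psi a = lpa_in k G (phi a).
Local Notation L := (leavitt k G).
Local Notation letter := (arrow G + arrow G)%type.
Local Notation word := (seq letter * vert G)%type.
Local Notation mono := (@mono k G).
Local Notation gen := (@gen k G).
Local Notation nwords n := (size (words G n)).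
Implicit Types (U : set k) (W : set L) (x y : L) (n m d : nat).

Lemma psi_scale a x : psi a * x = phi a *: x.
Proof. by rewrite psiE lpa_inE. Qed.

Lemma central_phi : central_map phi.
Proof. by move=> a x; exact: mulrC. Qed.

Lemma subspace_additive U : is_subspace phi U -> additive_set U.
Proof. by move=> sU; split; [exact: sU.1|move=> a b; exact: (subspaceB sU)]. Qed.

Lemma subspace_span_over U n : is_subspace phi U -> is_subspace psi (span_over (G := G) U n).
Proof.
move=> sU; have zU := subspace_additive sU; split; first exact: span_over0.
move=> a x y Ux Uy; apply: span_overD => //; rewrite psi_scale.
by apply: span_over_scale Ux => b; exact: (subspaceZ _ sU).
Qed.

Lemma span_over_fin (s : seq L) : exists (t : seq k) m,
  forall x, x \in s -> span_over (lin_span phi [set` t]) m x.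
Proof.
elim: s => [|x s [t [m IH]]]; first by exists [::], 0%N.
have [n [c [_ xE]]] := span_over_exhaust x.
pose t' := [seq c w | w <- words G n] ++ t.
have tt' : lin_span phi [set` t] `<=` lin_span phi [set` t'].
  apply: lin_span_sub; first exact: subspace_lin_span.
  by move=> a ta; apply: sub_lin_span; rewrite /= mem_cat; apply/orP; right.
have zt' : additive_set (lin_span phi [set` t']).
  exact/subspace_additive/subspace_lin_span.
exists t', (maxn n m) => y; rewrite in_cons => /orP[/eqP->|ys]; last first.
  by apply: span_over_sub (IH _ ys) => //; exact: leq_maxr.
rewrite xE; apply: span_over_sum => // -[l z] lz _.
have := lz; rewrite mem_words => /andP[nl sl].
apply: span_over_mono => //; last by apply: leq_trans sl _; exact: leq_maxl.
apply: sub_lin_span; rewrite /= mem_cat; apply/orP; left.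
by apply/mapP; exists (l, z).
Qed.

Lemma fin_dim_sub_span_over W : fin_dim_subspace psi W -> exists U m,
  [/\ fin_dim_subspace phi U, U 1 & W `<=` span_over U m].
Proof.
move=> [s ->]; have [t [m tP]] := span_over_fin s.
have sU := subspace_lin_span phi [set` 1 :: t].
exists (lin_span phi [set` 1 :: t]), m; split; first by exists (1 :: t).
  by apply: sub_lin_span; exact: mem_head.
apply: lin_span_sub; first exact: subspace_span_over.
move=> x xs; apply: span_over_sub (tP _ xs) => //; first exact: subspace_additive.
apply: lin_span_sub => // a ta; apply: sub_lin_span.
by rewrite /= in_cons; apply/orP; right.
Qed.

Lemma subspace_pow_span_over U W m n : W `<=` span_over U m ->
  subspace_pow psi W n `<=` span_over (subspace_pow phi U n) (n * m).
Proof.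
move=> WU; apply: lin_span_sub.
  by apply: subspace_span_over; exact: subspace_lin_span.
move=> _ [t Wt <-]; elim: n t Wt => [|n IH] t Wt.
  (* The empty product is the unit: a sum of words of length 0 with coefficient 1, itself an empty
     product of scalars. *)
  rewrite big_ord0 mul0n -[1]/(\sum_v lpa_vert k v).
  have zU : additive_set (subspace_pow phi U 0).
    exact/subspace_additive/subspace_lin_span.
  apply: span_over_sum => // v _ _; rewrite -mono0 -[mono _ _]scale1r.
  apply: span_over_mono => //; apply: sub_lin_span.
  by exists (fun=> 0); [case|rewrite big_ord0].
rewrite big_ord_recl mulSn.
apply: (span_over_mul (U := U) (U' := subspace_pow phi U n)).
- exact/subspace_additive/subspace_lin_span.
- by move=> a b Ua Ub; apply: subspace_powS => //; exact: central_phi.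
- exact/WU/Wt.
- by apply: IH => i; exact: Wt.
Qed.

Lemma lin_dim_span_over_le U n p (b : 'I_p -> k) (V : set L) :
  (forall a, U a -> exists c : 'I_p -> F, a = \sum_i phi (c i) * b i) ->
  V `<=` span_over U n -> (lin_dim R psi V <= (p * nwords n)%:R%:E)%E.
Proof.
move=> Ub VU; pose w j := tnth (in_tuple (words G n)) j.
have := @lin_dim_le R _ _ psi V ('I_p * 'I_(nwords n))%type
  (fun ij => b ij.1 *: mono (w ij.2).1 (w ij.2).2).
rewrite card_prod !card_ord; apply=> x /VU[c [Uc ->]].
have /choice[d dE] := fun v => Ub _ (Uc v).
exists (fun ij => d (w ij.2) ij.1); rewrite big_tnth -(pair_bigA _ (fun i j =>
  psi (d (w j) i) * (b i *: mono (w j).1 (w j).2)))/= exchange_big/=.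
apply: eq_bigr => j _; rewrite -/(w j) [in LHS]dE scaler_suml.
by apply: eq_bigr => i _; rewrite psi_scale scalerA.
Qed.

Lemma mono_indep n (d : 'I_(nwords n) -> k) :
  \sum_j d j *: mono (tnth (in_tuple (words G n)) j).1 (tnth (in_tuple (words G n)) j).2 = 0 ->
  forall j, d j = 0.
Proof.
set w := tnth _ => d0 j; have wn i : normal (w i).1 (w i).2.
  have := mem_tnth i (in_tuple (words G n)); rewrite -/w.
  by case: (w i) => l z; rewrite mem_words => /andP[].
have := congr1 (fun x => normal_coef x (w j).1 (w j).2) d0.
rewrite /= normal_coef0 normal_coef_sum (bigD1 j)//= normal_coefZ.
rewrite normal_coef_mono// eqxx mulr1 big1 ?addr0// => i ij.
rewrite normal_coefZ normal_coef_mono//; case: eqP => [wij|_]; last by rewrite mulr0.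
have /tuple_uniqP wI : uniq (in_tuple (words G n)) by exact: uniq_words.
suff ji : j = i by rewrite ji eqxx in ij.
by apply: wI; move: wij; rewrite -/w; case: (w j) (w i) => [? ?] [? ?].
Qed.

Lemma lin_dim_span_over_ge U n p (b : 'I_p -> k) (V : set L) :
  (forall i, U (b i)) -> lin_indep phi b ->
  (forall a l z, U a -> normal l z -> (size l <= n)%N -> V (a *: mono l z)) ->
  ((p * nwords n)%:R%:E <= lin_dim R psi V)%E.
Proof.
move=> Ub bi UV; pose w j := tnth (in_tuple (words G n)) j.
have := @lin_dim_ge R _ _ psi V ('I_p * 'I_(nwords n))%type
  (fun ij => b ij.1 *: mono (w ij.2).1 (w ij.2).2).
rewrite card_prod !card_ord; apply.
  move=> [i j] /=; have := mem_tnth j (in_tuple (words G n)); rewrite -/(w j).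
  by case: (w j) => l z; rewrite mem_words => /andP[nl sl]; exact: UV.
move=> c c0 [i j]; apply: (bi (fun i => c (i, j))).
apply: (mono_indep (d := fun j => \sum_i phi (c (i, j)) * b i)).
rewrite -[RHS]c0.
transitivity (\sum_i \sum_j psi (c (i, j)) * (b i *: mono (w j).1 (w j).2)); last first.
  by rewrite pair_bigA; apply: eq_bigr => -[].
rewrite exchange_big/=.
apply: eq_bigr => j' _; rewrite scaler_suml.
by apply: eq_bigr => i' _; rewrite psi_scale scalerA.
Qed.

Lemma fin_dim_span_over U n : fin_dim_subspace phi U ->
  fin_dim_subspace psi (span_over (G := G) U n).
Proof.
move=> [s Us]; exists [seq a *: mono w.1 w.2 | a <- s, w <- words G n].
have sU : is_subspace phi U by rewrite Us; exact: subspace_lin_span.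
have zU := subspace_additive sU.
apply/seteqP; split; last first.
  apply: lin_span_sub; first exact: subspace_span_over.
  move=> _ /allpairsP[[a [l z]] [/= sa + ->]]; rewrite mem_words => /andP[nl sl].
  by apply: span_over_mono => //; rewrite Us; exact: sub_lin_span.
move=> _ [c [Uc ->]]; set V := lin_span _ _; have sV : is_subspace psi V by exact: subspace_lin_span.
rewrite big_seq; apply: big_ind => [|x y Vx Vy|w wn].
- exact: sV.1.
- by rewrite -[x]mul1r -(rmorph1 psi); exact: sV.2.
have := Uc w; rewrite Us; apply: (@lin_span_sub _ _ _ _ [set a | V (a *: mono w.1 w.2)]).
  split=> [/=|a x y Vx Vy /=]; first by rewrite scale0r; exact: sV.1.
  by rewrite scalerDl -scalerA -psi_scale; exact: sV.2.
by move=> a sa; apply: sub_lin_span; exact: allpairs_f.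
Qed.

(** Letters are split off one at a time, and short words are padded by factors 1, which are sums of
    vertices. At least one factor is required, as it must carry the range vertex z. *)
Lemma mono_factor n l z : normal l z -> (size l <= n.+1)%N ->
  exists y : 'I_n.+1 -> L, (forall i, span_over (@int_scalars k) 1 (y i)) /\
    mono l z = \prod_i y i.
Proof.
elim: n l => [|n IH] l nl sl.
  by exists (fun=> mono l z); split; [move=> _; exact: int_span_mono|rewrite big_ord1].
have [x [l' [nl' sl' x1 lE]]] : exists x l', [/\ normal l' z, (size l' <= n.+1)%N,
    span_over (@int_scalars k) 1 x & mono l z = x * mono l' z].
  case: l nl sl => [|x l] nl sl; [exists 1, [::]|exists (gen x), l]; split => //.
  - have : span_over (@int_scalars k) 1 (\sum_v mono [::] v).
      apply: span_over_sum; first exact: additive_int_scalars.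
      by move=> v _ _; exact: int_span_mono.
    by [].
  - by rewrite mul1r.
  - exact: normal_tail nl.
  - by rewrite -mono1; apply: int_span_mono => //; rewrite normal_cons eqxx.
  - exact: mono_cons.
have [y [y1 yE]] := IH _ nl' sl'.
exists (fun i => oapp y x (unlift ord0 i)); split.
  by move=> i; case: unlift.
rewrite lE yE [RHS]big_ord_recl unlift_none /=; congr (_ * _).
by apply: eq_bigr => i _; rewrite liftK.
Qed.

Lemma scale_prod n (a : 'I_n -> k) (y : 'I_n -> L) :
  (\prod_i a i) *: \prod_i y i = \prod_i (a i *: y i).
Proof.
elim: n a y => [|n IH] a y; first by rewrite !big_ord0 scale1r.
by rewrite !big_ord_recl -IH lpa_scaleM.
Qed.

(** A product of n + 1 scalars from U and a word cut into n + 1 factors are matched factor by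
    factor, since scalars are central. *)
Lemma subspace_pow_mono U n a l z : is_subspace phi U ->
  subspace_pow phi U n.+1 a -> normal l z -> (size l <= n.+1)%N ->
  subspace_pow psi (span_over U 1) n.+1 (a *: mono l z).
Proof.
move=> sU Ua nl sl; have zU := subspace_additive sU; move: a Ua.
set V := subspace_pow psi _ _; have sV : is_subspace psi V by exact: subspace_lin_span.
apply: (@lin_span_sub _ _ _ _ [set a | V (a *: mono l z)]).
  split=> [/=|a x y Vx Vy /=]; first by rewrite scale0r; exact: sV.1.
  by rewrite scalerDl -scalerA -psi_scale; exact: sV.2.
move=> _ [a Ua <-] /=; have [y [y1 ->]] := mono_factor nl sl.
rewrite scale_prod; apply: sub_lin_span; exists (fun i => a i *: y i) => // i.
apply: span_over_scale (y1 i) => _ [j ->]; exact: additive_int_scalar.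
Qed.

End ScalarExtension.

(** * The two inequalities and the sum formula *)

Section GrowthComparison.
Variables (R : realType) (F : fieldType) (k : comPzRingType).
Variables (phi : {rmorphism F -> k}) (G : digraph).
Variable psi : {rmorphism F -> leavitt k G}.
Hypothesis psiE : forall a, psi a = lpa_in k G (phi a).
Hypotheses (k1 : 1 <> 0 :> k) (G0 : (0 < #|vert G|)%N).
Local Notation L := (leavitt k G).
Local Notation nwords n := (size (words G n)).
Implicit Types (U : set k) (W : set L) (n m d : nat).

Lemma leavitt1_neq0 : 1 <> 0 :> L.
Proof.
move=> L0; have [v _] := card_gt0P G0; apply: k1.
have := congr1 (fun x : L => normal_coef x [::] v) L0.
rewrite -[1]/(\sum_v lpa_vert k v) /= normal_coef0 normal_coef_sum (bigD1 v)//= -mono0.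
rewrite normal_coef_mono// eqxx big1 ?addr0// => v' v'v.
by rewrite -mono0 normal_coef_mono// xpair_eqE eqxx eq_sym (negbTE v'v).
Qed.

Lemma size_words_gt0 n : (0 < nwords n)%N.
Proof. by rewrite size_words addn_gt0 G0. Qed.

Lemma pow_basis U n : fin_dim_subspace phi U -> U 1 ->
  exists p (b : 'I_p -> k), [/\ (0 < p)%N, lin_indep phi b,
    forall i, subspace_pow phi U n (b i),
    forall x, subspace_pow phi U n x -> exists c : 'I_p -> F, x = \sum_i phi (c i) * b i &
    lin_dim R phi (subspace_pow phi U n) = p%:R%:E].
Proof.
move=> fU U1; have [s Us] := subspace_pow_fin (@central_phi F k phi) n fU.
have sU : is_subspace phi (subspace_pow phi U n) by exact: subspace_lin_span.
have [p [b [Ub bi bspan dimp]]] := lin_basis R sU Us; exists p, b; split => //.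
have := @lin_dim_ge1 R _ _ phi _ k1 (subspace_pow1 phi n U1).
by rewrite dimp lee_fin ler1n.
Qed.

Lemma GKdim_leavitt_le d : grows_at_most d (fun n => nwords n) ->
  (GKdim R psi <= GKdim R phi + d%:R%:E)%E.
Proof.
move=> [c cD]; apply: GKdim_le => W fW W1.
have [U [m [fU U1 WU]]] := fin_dim_sub_span_over psiE fW.
have sU : is_subspace phi U by case: fU => s ->; exact: subspace_lin_span.
(* The length bound is made positive because the estimate on the number of words is available at n m
   only if this is positive. *)
have {}WU : W `<=` span_over U m.+1.
  apply: subset_trans WU _ => x; apply: span_over_sub => //.
  exact: subspace_additive sU.
apply: (@le_trans _ _ (growth_exponent R phi U + d%:R%:E)%E); last first.
  by rewrite leeD2r// GKdim_ge.
(* The factor (m + 1)^d comes from word lengths up to n (m + 1); the successor makes the constant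
   positive. *)
apply: (@limn_esup_shift _ _ _ _ (ln (c * m.+1 ^ d).+1%:R)) => [n|n n1].
  exact/growth_term_ge0/lin_dim_ge1/subspace_pow1.
have [p [b [p0 bi _ bspan ->]]] := pow_basis n fU U1.
apply: lne_term_le => //.
  by apply: ereal_sup_ubound; exists 0%N => //; exists (fun=> 0); split => [[]|? _ []].
have := lin_dim_span_over_le R psiE bspan (subspace_pow_span_over psiE WU).
move=> /le_trans; apply; rewrite lee_fin ler_nat leq_mul2l; apply/orP; right.
apply: leq_trans (cD _ _) _; first by rewrite muln_gt0 ltnW.
by rewrite expnMn (mulnC (n ^ d)%N) mulnA leq_mul2r leqnSn orbT.
Qed.

(** The test space for U is [span_over U 1]. Moving d to the other side leaves a supremum over all U
    to be bounded. *)
Lemma GKdim_leavitt_ge d : grows_at_least d (fun n => nwords n) ->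
  (GKdim R phi + d%:R%:E <= GKdim R psi)%E.
Proof.
move=> [c cD]; rewrite -leeBrDr//; apply: GKdim_le => U fU U1.
have sU : is_subspace phi U by case: fU => s ->; exact: subspace_lin_span.
have W1 : span_over (G := G) U 1 1.
  rewrite -[1]/(\sum_v lpa_vert k v); apply: span_over_sum => //.
    exact: subspace_additive sU.
  move=> v _ _; rewrite -mono0 -[mono _ _ _]scale1r; apply: span_over_mono => //.
  exact: subspace_additive sU.
apply: (@le_trans _ _ (growth_exponent R psi (span_over U 1) - d%:R%:E)%E); last first.
  by rewrite leeB// GKdim_ge//; exact: fin_dim_span_over.
apply: (@limn_esup_shift _ _ _ _ (ln c%:R)) => [n|[//|n] n1].
  by apply/growth_term_ge0/lin_dim_ge1/subspace_pow1 => //; exact: leavitt1_neq0.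
have [p [b [p0 bi Ub _ ->]]] := pow_basis n.+1 fU U1.
apply: (lne_term_ge n1 p0 (size_words_gt0 n.+1) (cD _ _)) => //.
apply: (lin_dim_span_over_ge R psiE Ub bi) => a l z Ua nl sl.
exact: subspace_pow_mono.
Qed.

End GrowthComparison.

(** [D] is chosen before [k]. The structure map [psi] is given only up to pointwise equality, so
    that the result applies both to [lpa_alg phi G] and to [lpa_in F G]. *)
Lemma GKdim_leavitt (R : realType) (F : fieldType) (G : digraph) : (0 < #|vert G|)%N ->
  exists D : \bar R, forall (k : comPzRingType) (phi : {rmorphism F -> k})
    (psi : {rmorphism F -> leavitt k G}), (forall a, psi a = lpa_in k G (phi a)) ->
  1 <> 0 :> k -> GKdim R psi = (GKdim R phi + D)%E.
Proof.
move=> G0; have [Dall|[d [dD Dd]]] := words_rate G0; last first.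
  exists d%:R%:E => k phi psi psiE k1; apply/eqP; rewrite eq_le.
  by rewrite GKdim_leavitt_le//= GKdim_leavitt_ge.
exists +oo%E => k phi psi psiE k1; have phi0 := @GKdim_ge0 R _ _ phi k1.
rewrite addey; last by move: phi0; case: GKdim.
apply/eqyP => r r0.
have := @GKdim_leavitt_ge R _ _ _ _ _ psiE k1 G0 _ (Dall (Num.truncn r).+1).
apply: le_trans; rewrite -[r%:E]add0e leeD// lee_fin ltW//.
exact: truncnS_gt.
Qed.

Theorem theorem26 (R : realType) (F : fieldType) (k : comPzRingType)
    (phi : {rmorphism F -> k}) (G : digraph) :
  central_map (lpa_alg phi G) /\
  GKdim R (lpa_alg phi G) = (GKdim R (lpa_in F G) + GKdim R phi)%E.
Proof.
split; first by move=> a x; exact: lpa_in_comm.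
have psiE a : lpa_alg phi G a = lpa_in k G (phi a) by [].
(* For a zero ring [k] the dimensions of [k] and of L_k are -oo, and adding -oo to any extended
   real, even +oo, gives -oo. The empty digraph is similar, both path algebras being zero. *)
have [k0|k1] := pselect (1 = 0 :> k).
  rewrite (GKdim_trivial R phi k0) addeNy GKdim_trivial//.
  by rewrite -[1](rmorph1 (lpa_in k G)) k0 rmorph0.
have [G0|] := posnP #|vert G|.
  have L0 (k' : comPzRingType) : 1 = 0 :> leavitt k' G.
    by rewrite -[1]/(\sum_v lpa_vert k' v) big_pred0// => v; have := card0_eq G0 v.
  by rewrite (GKdim_trivial R _ (L0 k)) (GKdim_trivial R _ (L0 F)) addNye.
move=> /(GKdim_leavitt R F)[D DE].
rewrite (DE _ _ _ psiE k1) addeC; congr (_ + _)%E.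
rewrite (DE F idfun (lpa_in F G)) ?GKdim_id ?add0e//.
exact/eqP/oner_neq0.
Qed.
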